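(* Let $G=(N,E)$ be a finite simple graph with weights $w:N\to\mathbb{R}_{++}$. Let $x^*$ and $\mu^*$ be optimal solutions of (LP-P) and (LP-D) respectively, each in the relative interior of the optimal face (the set of optimal solutions) of its feasible region, and let $\mathcal{V}_{\mathrm{LP}}$ be the set function $\mathcal{V}_{\mathrm{LP}}(S)=\sum_{C\in\mathcal{C}(G),\,C\cap S\neq\emptyset}\mu^*_C$. Consider the Rounding Algorithm executed with input $x^*$ and $\mathcal{V}_{\mathrm{LP}}$. (a) If $G$ is unipolar, chordal, or co-chordal, then the Rounding Algorithm returns a maximum weighted stable set of $G$ (whatever arbitrary choices are made during its execution). (b) Assume $G$ is co-unipolar, and let $i,j$ be any two adjacent vertices remaining after Phase I. Then either the Rounding Algorithm returns a maximum weighted stable set whenever Phase II starts by selecting $i$ (i.e. $i$ is the vertex chosen in step (1) of the first iteration), or it returns a maximum weighted stable set whenever Phase II starts by selecting $j$.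
   Context: For a vertex $i$, $\delta_i$ is the set of neighbors of $i$ in $G$. A maximum weighted stable set (MWSS) is a stable set $S$ maximizing $\sum_{i\in S}w_i$; $\alpha(I)$ is the maximum weight of a stable set of the induced subgraph $G|_I$. $\mathcal{C}(G)$ is the set of all (nonempty) cliques of $G$. (LP-P): maximize $w^\top x$ subject to $x\in\mathbb{R}^N$, $x\ge 0$, $\sum_{i\in C}x_i\le 1$ for all $C\in\mathcal{C}(G)$. (LP-D): minimize $\sum_{C\in\mathcal{C}(G)}\mu_C$ subject to $\mu\ge 0$, $\sum_{C\ni i}\mu_C\ge w_i$ for all $i\in N$. Graph classes: $G$ is unipolar if $N=A\cup\overline{A}$ (a partition) where $G|_A$ is complete and every connected component of $G|_{\overline{A}}$ is complete; co-unipolar if its complement is unipolar; chordal if it has no induced cycle of length at least four; co-chordal if its complement is chordal. (All these graphs are perfect.) Value function approximation (VFA): a function $\mathcal{V}:2^N\to\mathbb{R}_+$ with $\mathcal{V}(\emptyset)=0$, monotone under inclusion, and $\mathcal{V}(S)-\mathcal{V}(S\setminus(\{i\}\cup\delta_i))\ge w_i$ for all $S\subseteq N$, $i\in S$. It is tight if $\mathcal{V}(N)=\alpha(N)$. Rounding Algorithm. Input: $G$, $w$, a maximizer $x^*$ of $w^\top x$ over the convex hull of incidence vectors of stable sets of $G$, and a tight VFA $\mathcal{V}$. Phase I: $S\gets\emptyset$, $I\gets\{i\in N: x^*_i>0\}$. Phase II: while $I\ne\emptyset$, perform one iteration: (1) set $I'\gets I$, choose an arbitrary $i\in I'$, and set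 $I'\gets I'\setminus(\{i\}\cup\delta_i)$; (2) while there is $j\in I'$ with $\mathcal{V}(I')-\mathcal{V}(I'\setminus(\{j\}\cup\delta_j))>w_j$, pick such a $j$ and set $I'\gets I'\setminus\{j\}$; (3) (look-ahead) if $\mathcal{V}(I)>\mathcal{V}(I')+w_i$, set $I\gets I\setminus\{i\}$; otherwise set $I\gets I'$ and $S\gets S\cup\{i\}$. Output: $S$. *)

(* Defs.v *)
From mathcomp Require Import all_boot all_order all_algebra.
From mathcomp Require Import reals.

Set Implicit Arguments.
Unset Strict Implicit.
Unset Printing Implicit Defensive.

Import Order.TTheory GRing.Theory Num.Theory.
Local Open Scope ring_scope.

(* A graph is an irreflexive symmetric relation [e] on a finite type [N] of
   vertices; both properties are hypotheses of the theorem. *)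
Section Graphs.
Variables (N : finType) (e : rel N).

Definition nbhd (i : N) : {set N} := [set j | e i j].

Definition stable (S : {set N}) : bool :=
  [forall i in S, forall j in S, ~~ e i j].

Definition complete_on (A : {set N}) : bool :=
  [forall i in A, forall j in A, (i != j) ==> e i j].

Definition clique_pred (C : {set N}) : bool := (C != set0) && complete_on C.

Definition clique : finType := {C : {set N} | clique_pred C}.

Definition induced (B : {set N}) : rel N :=
  [rel x y | [&& x \in B, y \in B & e x y]].

Definition component (B : {set N}) (x : N) : {set N} :=
  [set y in B | connect (induced B) x y].

Definition compl_graph : rel N := [rel x y | (x != y) && ~~ e x y].

Definition unipolar : Prop :=
  exists A : {set N},
    complete_on A /\ forall x, x \in ~: A -> complete_on (component (~: A) x).

(* The vertices of [c] are distinct and the edges of [e] among them are exactly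
   the pairs of cyclically consecutive vertices of [c]; this describes a cycle
   only when [3 <= size c]. *)
Definition induced_cycle (c : seq N) : Prop :=
  uniq c /\
  {in c &, forall x y, e x y = (y == next c x) || (x == next c y)}.

Definition chordal : Prop :=
  forall c : seq N, induced_cycle c -> (size c < 4)%N.

End Graphs.

Definition co_unipolar (N : finType) (e : rel N) : Prop :=
  unipolar (compl_graph e).

Definition co_chordal (N : finType) (e : rel N) : Prop :=
  chordal (compl_graph e).

Section RelativeInterior.
Variables (R : realType) (I : finType).

Definition affine_hull (F : {ffun I -> R} -> Prop) (y : {ffun I -> R}) : Prop :=
  exists (n : nat) (p : 'I_n -> {ffun I -> R}) (c : 'I_n -> R),
    [/\ forall k, F (p k), \sum_(k < n) c k = 1
      & forall i, y i = \sum_(k < n) c k * p k i].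

(* Balls are those of the sup norm, which induces the usual topology of R^I. *)
Definition relint (F : {ffun I -> R} -> Prop) (x : {ffun I -> R}) : Prop :=
  F x /\
  exists2 eps : R, 0 < eps &
    forall y, affine_hull F y -> (forall i, `|y i - x i| < eps) -> F y.

End RelativeInterior.

Section LinearPrograms.
Variables (R : realType) (N : finType) (e : rel N) (w : N -> R).

Definition mwss (S : {set N}) : Prop :=
  stable e S /\
  forall T : {set N}, stable e T -> \sum_(i in T) w i <= \sum_(i in S) w i.

Definition primal_feasible (x : {ffun N -> R}) : Prop :=
  (forall i, 0 <= x i) /\
  (forall C : clique e, \sum_(i in val C) x i <= 1).

Definition primal_optimal (x : {ffun N -> R}) : Prop :=
  primal_feasible x /\
  forall y, primal_feasible y -> \sum_i w i * y i <= \sum_i w i * x i.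

Definition dual_feasible (mu : {ffun clique e -> R}) : Prop :=
  (forall C, 0 <= mu C) /\
  (forall i, w i <= \sum_(C : clique e | i \in val C) mu C).

Definition dual_optimal (mu : {ffun clique e -> R}) : Prop :=
  dual_feasible mu /\ forall nu, dual_feasible nu -> \sum_C mu C <= \sum_C nu C.

Definition VLP (mu : {ffun clique e -> R}) (S : {set N}) : R :=
  \sum_(C : clique e | val C :&: S != set0) mu C.

End LinearPrograms.

(* The algorithm is a relation between its input and its possible outputs, one
   output for each way of resolving the arbitrary choices. *)
Section Rounding.
Variables (R : realType) (N : finType) (e : rel N) (w : N -> R).
Variable V : {set N} -> R.

Definition removable (I : {set N}) (j : N) : bool :=
  (j \in I) && (V I - V (I :\: (j |: nbhd e j)) > w j).

(* [prune I I'] : some execution of the inner loop (2) leads from I to I'. *)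
Inductive prune : {set N} -> {set N} -> Prop :=
| prune_stop I : (forall j, ~~ removable I j) -> prune I I
| prune_step I j I' : removable I j -> prune (I :\ j) I' -> prune I I'.

(* One iteration of Phase II from the state (I, S), choosing i in step (1). *)
Definition iteration (i : N) (st st' : {set N} * {set N}) : Prop :=
  let I := st.1 in let S := st.2 in
  i \in I /\
  exists2 I', prune (I :\: (i |: nbhd e i)) I' &
    st' = if V I > V I' + w i then (I :\ i, S) else (I', i |: S).

Inductive phase2 : {set N} * {set N} -> {set N} -> Prop :=
| phase2_stop S : phase2 (set0, S) S
| phase2_step i st st' T : iteration i st st' -> phase2 st' T -> phase2 st T.

Definition phase1 (x : {ffun N -> R}) : {set N} := [set i | 0 < x i].

Definition rounding (x : {ffun N -> R}) (T : {set N}) : Prop :=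
  phase2 (phase1 x, set0) T.

Definition rounding_from (i : N) (x : {ffun N -> R}) (T : {set N}) : Prop :=
  exists2 st, iteration i (phase1 x, set0) st & phase2 st T.

(* No execution can get stuck or run forever, so that quantifying over all
   outputs of [rounding] or [rounding_from] is never vacuous. *)
Lemma prune_total (I : {set N}) : exists I', prune I I'.
Proof.
have [n] := ubnP #|I|; elim: n I => // n IH I leI.
have [/existsP[j rj]|/existsPn nr] := boolP [exists j, removable I j]; last first.
  by exists I; apply: prune_stop.
have [jI _] := andP rj; have [I' pI'] : exists I', prune (I :\ j) I'.
  by apply: IH; move: leI; rewrite (cardsD1 j) jI.
by exists I'; apply: prune_step rj pI'.
Qed.

Lemma prune_sub (I I' : {set N}) : prune I I' -> I' \subset I.
Proof.
by elim=> // {}I j {}I' _ _ sI'; apply: subset_trans sI' (subD1set _ _).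
Qed.

Lemma iteration_total i (I S : {set N}) :
  i \in I -> exists st, iteration i (I, S) st.
Proof.
move=> iI; have [I' pI'] := prune_total (I :\: (i |: nbhd e i)).
by eexists; split=> //; exists I'.
Qed.

Lemma iteration_card i st st' : iteration i st st' -> (#|st'.1| < #|st.1|)%N.
Proof.
case: st => I S [iI [I' /prune_sub sI' ->]]; apply: proper_card.
apply: sub_proper_trans (properD1 iI).
case: ifP => _ //=; apply: subset_trans sI' _.
by apply: setDS; rewrite sub1set setU11.
Qed.

Lemma phase2_total st : exists T, phase2 st T.
Proof.
have [n] := ubnP #|st.1|; elim: n st => // n IH [I S] leI.
have [->|[i iI]] := set_0Vmem I; first by exists S; apply: phase2_stop.
have [st' it] := iteration_total S iI.
have [T pT] := IH st' (leq_trans (iteration_card it) leI).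
by exists T; apply: phase2_step it pT.
Qed.

Lemma rounding_from_total i x :
  i \in phase1 x -> exists T, rounding_from i x T.
Proof.
move=> ix; have [st it] := iteration_total set0 ix.
by have [T pT] := phase2_total st; exists T, st.
Qed.

End Rounding.

(* Main.v *)
(** Call a clique [C] positive if [mu C > 0]. By complementary slackness the
    vertices of [phase1 x] have zero dual slack and a positive clique has
    [x]-load 1; as both solutions are relatively interior, the converse holds as
    well: every clique of load 1 is positive.

    Say that a stable set [T] is transversal to [I] if it meets every positive
    clique that meets [I]. A removable vertex of a state is adjacent to the whole
    trace of some positive clique, so pruning never removes a vertex of a
    transversal stable set; conversely, after pruning, all nonempty traces of
    positive cliques are maximal cliques of the subgraph induced by the state
    ("clean"). If every clean [I] has a transversal stable subset, then the
    existence of a transversal, together with w(S) + V(I) >= sum of [mu], is a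
    loop invariant: a discarded vertex lies in no transversal and discarding it
    leaves V unchanged. At the end w(S) >= sum of [mu], and [S] is maximum by weak
    duality.

    Clean sets have transversals in chordal graphs (remove a simplicial vertex and
    induct), in co-chordal graphs (take a simplicial vertex [v] of the complement
    together with all its nonneighbours), in unipolar graphs (any vertex [b] of [A]
    extends to one, by uncrossing positive cliques) and in bipartite graphs. In a
    co-unipolar graph one end [i] of an edge lies outside the stable set [A]; it
    belongs to a transversal obtained by thresholding [x] at [x i], and after it
    is chosen the remaining graph is bipartite. *)
Require Import Defs.
From mathcomp Require Import all_boot all_order all_algebra.
From mathcomp Require Import reals.
From mathcomp Require Import ring lra.

Set Implicit Arguments.
Unset Strict Implicit.
Unset Printing Implicit Defensive.

Import Order.TTheory GRing.Theory Num.Theory.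
Local Open Scope ring_scope.

(** * Farkas' lemma *)

Section Farkas.
Variables (R : realFieldType) (N : finType) (J : eqType).
Implicit Types (a : J -> N -> R) (b d u v : N -> R) (s : seq J).

Definition dot u v : R := \sum_i u i * v i.

Lemma dotBZl u v t d : dot (fun i => u i - t * v i) d = dot u d - t * dot v d.
Proof.
by rewrite /dot mulr_sumr -sumrB; apply: eq_bigr => i _; ring.
Qed.

Lemma dotBZr u v t d : dot d (fun i => u i - t * v i) = dot d u - t * dot d v.
Proof.
by rewrite /dot mulr_sumr -sumrB; apply: eq_bigr => i _; ring.
Qed.

Fixpoint cone a s b : Prop :=
  if s is j :: s' then exists2 t, 0 <= t & cone a s' (fun i => b i - t * a j i)
  else forall i, b i = 0.

Lemma eq_cone a s b b' : b =1 b' -> cone a s b -> cone a s b'.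
Proof.
elim: s b b' => [|j s IH] b b' bb' /=; first by move=> b0 i; rewrite -bb'.
by case=> t t0 c; exists t => //; apply: IH c => i; rewrite bb'.
Qed.

Lemma cone_ind (Q : (N -> R) -> Prop) a s b :
    (forall u u', u =1 u' -> Q u -> Q u') ->
    Q (fun=> 0) ->
    (forall u v t, 0 <= t -> Q u -> Q v -> Q (fun i => u i + t * v i)) ->
    (forall j, j \in s -> Q (a j)) ->
  cone a s b -> Q b.
Proof.
move=> Qe Q0 QD; elim: s b => [|j s IH] b Qa /=.
  by move=> b0; apply: Qe Q0 => i; rewrite b0.
case=> t t0 /IH Qb.
have {}Qb : Q (fun i => b i - t * a j i).
  by apply: Qb => k ks; apply: Qa; rewrite inE ks orbT.
by apply: Qe (QD _ _ _ t0 Qb (Qa j (mem_head _ _))) => i; rewrite subrK.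
Qed.

(** Undoes the projection along [v]: a generator taken with coefficient [t] contributes [- t * c j],
    which is nonnegative, to the multiple of [v]. *)
Lemma cone_shift a s (c : J -> R) v b :
    (forall j, j \in s -> c j <= 0) ->
    cone (fun j i => a j i - c j * v i) s b ->
  exists2 t, 0 <= t & cone a s (fun i => b i - t * v i).
Proof.
elim: s b => [|j s IH] b c0 /=.
  by move=> b0; exists 0 => // i; rewrite b0 mul0r subrr.
case=> t t0 /IH[|t' t'0 h]; first by move=> k ks; rewrite c0 ?inE ?ks ?orbT.
exists (t' - t * c j).
  by rewrite subr_ge0 (le_trans _ t'0) // mulr_ge0_le0 // c0 ?mem_head.
by exists t => //; apply: eq_cone h => i; ring.
Qed.

(* Gale's induction: when the separator [d] obtained for [s] fails at the new
   generator [a j], project everything along [a j] onto the hyperplane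
   orthogonal to [d]. *)
Lemma farkas a s b :
  cone a s b \/
  exists d, (forall j, j \in s -> dot (a j) d <= 0) /\ 0 < dot b d.
Proof.
elim: s a b => [|j s IH] a b /=.
  have [/forallP b0|/forallPn[i bi]] := boolP [forall i, b i == 0].
    by left=> i; apply/eqP.
  right; exists b; split=> //; rewrite /dot (bigD1 i) //=.
  apply: ltr_pwDl; first by rewrite -expr2 exprn_even_gt0.
  by apply: sumr_ge0 => k _; rewrite -expr2 sqr_ge0.
case: (IH a b) => [c|[d [ad bd]]].
  by left; exists 0 => //; apply: eq_cone c => i; rewrite mul0r subr0.
have [ajd|ajd] := leP (dot (a j) d) 0.
  by right; exists d; split=> // k; rewrite inE => /predU1P[->|/ad].
(* With these coefficients [a k - c k * a j] and [b - cb * a j] are orthogonal to [d]. *)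
pose c k := dot (a k) d / dot (a j) d; pose cb := dot b d / dot (a j) d.
case: (IH (fun k i => a k i - c k * a j i) (fun i => b i - cb * a j i)).
  case/cone_shift=> [k /ad akd|t t0 h].
    by rewrite /c ler_pdivrMr // mul0r.
  left; exists (t + cb); first by rewrite addr_ge0 // /cb divr_ge0 ?ltW.
  by apply: eq_cone h => i; ring.
case=> d' [ad' bd']; right.
(* The adjoint of that projection applied to [d']: its product with a vector is the product of [d']
   with the projected vector, hence zero for [a j]. *)
exists (fun i => d' i - (dot (a j) d' / dot (a j) d) * d i); split=> [k|].
  rewrite dotBZr inE => /predU1P[->|/ad'].
    by rewrite divfK ?gt_eqF // subrr.
  rewrite dotBZl /c => h; apply: le_trans h.
  by rewrite le_eqVlt; apply/orP; left; apply/eqP; ring.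
move: bd'; rewrite dotBZr dotBZl /cb => h.
by apply: lt_le_trans h _; rewrite le_eqVlt; apply/orP; left; apply/eqP; ring.
Qed.

End Farkas.

(** * Small steps along a direction and past relatively interior points *)

Section Perturbation.
Variables (R : realType) (I : finType).

Lemma small_step (J : finType) (a b : J -> R) :
    (forall j, 0 <= a j) -> (forall j, a j = 0 -> 0 <= b j) ->
  exists2 t, 0 < t & forall j, 0 <= a j + t * b j.
Proof.
move=> a0 b0.
(* Ratio test: where [a j] vanishes every step is safe and [1] is an arbitrary bound; elsewhere
   [1 +] keeps the denominator positive. *)
pose f j := if a j == 0 then 1 else a j / (1 + `|b j|).
have den j : 0 < 1 + `|b j| by rewrite ltr_pwDl.
pose t := \big[Order.min/1]_j f j.
have t0 : 0 < t.
  rewrite /t; elim/big_ind: _ => // [u v u0 v0|j _]; first by rewrite lt_min u0.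
  by rewrite /f; case: eqP => // /eqP aj; rewrite divr_gt0 // lt0r aj a0.
exists t => // j.
have : t <= f j by rewrite /t (bigD1 j) //= ge_min lexx.
rewrite /f; case: eqP => [aj _|_ tj]; first by rewrite aj add0r mulr_ge0 ?b0 // ltW.
have : t * `|b j| <= a j.
  move: tj; rewrite ler_pdivlMr // mulrDr mulr1; lra.
have : t * - b j <= t * `|b j| by rewrite ler_wpM2l ?(ltW t0) // -normrN ler_norm.
rewrite mulrN; lra.
Qed.

(** The segment from [z] to [x] can be prolonged past [x], because the points beyond [x] are affine
    combinations of the two. *)
Lemma relint_extend (F : {ffun I -> R} -> Prop) x z :
    relint F x -> F z ->
  exists2 t, 0 < t & F [ffun i => x i + t * (x i - z i)].
Proof.
case=> Fx [eps eps0 ball] Fz.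
(* [M] exceeds every coordinate of the difference in absolute value, so the step [eps / M] stays in
   the ball. *)
pose M := 1 + \sum_i `|x i - z i|.
have M0 : 0 < M by rewrite ltr_pwDl // sumr_ge0.
exists (eps / M); first by rewrite divr_gt0.
apply: ball => [|i]; last first.
  rewrite ffunE addrAC subrr add0r normrM gtr0_norm ?divr_gt0 //.
  rewrite mulrAC ltr_pdivrMr // ltr_pM2l // /M (bigD1 i) //= addrCA ltrDl.
  by rewrite ltr_pwDl // sumr_ge0.
exists 2, (fun k => if k == ord0 then x else z),
  (fun k => if k == ord0 then 1 + eps / M else - (eps / M)); split=> [k||i].
- by case: ifP.
- by rewrite !big_ord_recl big_ord0 /=; ring.
by rewrite !big_ord_recl big_ord0 /= ffunE; ring.
Qed.

End Perturbation.

(** * Strict complementarity *)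

Section Duality.
Variables (R : realType) (N : finType) (e : rel N) (w : N -> R).
Implicit Types (x d : N -> R) (nu : clique e -> R) (C : clique e).

Definition load x C : R := \sum_(i in val C) x i.
Definition cover nu i : R := \sum_(C : clique e | i \in val C) nu C.

Lemma sum_load_cover nu x :
  \sum_C nu C * load x C = \sum_i x i * cover nu i.
Proof.
under eq_bigr do rewrite mulr_sumr big_mkcond.
rewrite exchange_big; apply: eq_bigr => i _ /=.
rewrite mulr_sumr [RHS]big_mkcond; apply: eq_bigr => C _.
by case: ifP => // _; rewrite mulrC.
Qed.

Lemma loadDZ x t d C : load (fun i => x i + t * d i) C = load x C + t * load d C.
Proof. by rewrite /load mulr_sumr -big_split. Qed.

Lemma coverDZ nu t nu' i :
  cover (fun C => nu C + t * nu' C) i = cover nu i + t * cover nu' i.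
Proof. by rewrite /cover mulr_sumr -big_split. Qed.

Lemma cover_unit C i : cover (fun D => (D == C)%:R) i = (i \in val C)%:R.
Proof.
rewrite /cover big_mkcond (bigD1 C) //= eqxx big1 ?addr0.
  by case: (i \in val C).
by move=> D /negPf ->; case: ifP.
Qed.

Lemma weak_duality x nu :
    (forall i, 0 <= x i) -> (forall C, load x C <= 1) ->
    (forall C, 0 <= nu C) -> (forall i, w i <= cover nu i) ->
  \sum_i w i * x i <= \sum_C nu C * load x C <= \sum_C nu C.
Proof.
move=> x0 x1 nu0 nuw; apply/andP; split.
  rewrite sum_load_cover; apply: ler_sum => i _.
  by rewrite mulrC ler_wpM2l.
by apply: ler_sum => C _; rewrite -[leRHS]mulr1 ler_wpM2l.
Qed.

(* [inl C] stands for [x(C) <= 1] and [inr k] for [- x_k <= 0]. *)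
Definition gradient (j : clique e + N) : N -> R :=
  match j with
  | inl C => fun i => (i \in val C)%:R
  | inr k => fun i => - (i == k)%:R
  end.

Lemma dot_gradient j d :
  dot (gradient j) d = match j with inl C => load d C | inr k => - d k end.
Proof.
case: j => [C|k]; rewrite /dot /=.
  rewrite /load [RHS]big_mkcond; apply: eq_bigr => i _.
  by case: ifP; rewrite ?mul1r ?mul0r.
rewrite (bigD1 k) //= eqxx big1 ?addr0 ?mulN1r // => i /negPf->.
by rewrite oppr0 mul0r.
Qed.

Section Optimum.
Variable x : {ffun N -> R}.
Hypothesis x_opt : primal_optimal e w x.

Let x_ge0 i : 0 <= x i. Proof. by case: x_opt => -[]. Qed.
Let load_x C : load x C <= 1. Proof. by case: x_opt => -[_ h] _; apply: h. Qed.

Definition active : seq (clique e + N) :=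
  [seq j <- enum {: clique e + N} |
     match j with inl C => load x C == 1 | inr k => x k == 0 end].

Lemma active_load C : (inl C \in active) = (load x C == 1).
Proof. by rewrite mem_filter mem_enum andbT. Qed.

Lemma active_zero k : (inr k \in active) = (x k == 0).
Proof. by rewrite mem_filter mem_enum andbT. Qed.

Lemma feasible_direction d :
    (forall j, j \in active -> dot (gradient j) d <= 0) ->
  exists2 t, 0 < t & primal_feasible e [ffun i => x i + t * d i].
Proof.
move=> dP.
pose slack (j : clique e + N) :=
  match j with inl C => 1 - load x C | inr k => x k end.
have [|j slack0|t t0 tP] := @small_step _ _ slack (fun j => - dot (gradient j) d).
- by case=> [C|k] /=; rewrite ?subr_ge0.
- rewrite oppr_ge0 dP //; case: j slack0 => [C|k] /=.
    by rewrite active_load => /eqP; rewrite subr_eq0 eq_sym.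
  by rewrite active_zero => ->.
exists t => //; split=> [i|C].
  by have := tP (inr i); rewrite dot_gradient /= opprK ffunE.
have := tP (inl C); rewrite dot_gradient /= => h.
have -> : \sum_(i in val C) [ffun i => x i + t * d i] i = load x C + t * load d C.
  by rewrite -loadDZ; apply: eq_bigr => i _; rewrite ffunE.
by move: h; rewrite mulrN; lra.
Qed.

(** A dual solution for the objective [b] in complementary slackness with [x]. The objective varies
    so that certificates of different objectives can be added. *)
Definition certifies b nu : Prop :=
  [/\ forall C, 0 <= nu C, forall C, load x C != 1 -> nu C = 0,
      forall i, b i <= cover nu i & forall i, 0 < x i -> b i = cover nu i].

Lemma eq_certifies b b' nu : b =1 b' -> certifies b nu -> certifies b' nu.
Proof.
by move=> bb' [h1 h2 h3 h4]; split=> // i; rewrite -bb'; [apply: h3 | apply: h4].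
Qed.

Lemma certifiesDZ b nu b' nu' t : 0 <= t ->
    certifies b nu -> certifies b' nu' ->
  certifies (fun i => b i + t * b' i) (fun C => nu C + t * nu' C).
Proof.
move=> t0 [nu0 nuT nub nue] [nu'0 nu'T nu'b nu'e]; split=> [C|C xC|i|i xi].
- by rewrite addr_ge0 // mulr_ge0.
- by rewrite nuT // nu'T // mulr0 addr0.
- by rewrite coverDZ lerD // ler_wpM2l.
- by rewrite coverDZ nue // nu'e.
Qed.

Lemma certifies_tight C : load x C = 1 ->
  certifies (gradient (inl C)) (fun D => (D == C)%:R).
Proof.
move=> xC; split=> [D|D|i|i _]; rewrite ?ler0n ?cover_unit //.
by have [->|] := eqVneq D C; rewrite // xC eqxx.
Qed.

Lemma certifies0 : certifies (fun=> 0) (fun=> 0).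
Proof. by split=> // i; rewrite /cover big1. Qed.

(** The unit vector at [C] certifies the gradient of a tight clique; zero certifies that of an
    active sign constraint, since where [x k = 0] only an inequality is required. *)
Lemma cone_active_certified b :
  cone gradient active b -> exists nu, certifies b nu.
Proof.
apply: (cone_ind (Q := fun u => exists nu, certifies u nu)) 
    => [u u' uu' [nu cu]||u v t t0 [nu cu] [nu' cv]|[C|k]] /=.
- by exists nu; apply: eq_certifies cu.
- by exists (fun=> 0); apply: certifies0.
- by exists (fun C => nu C + t * nu' C); apply: certifiesDZ.
- rewrite active_load => /eqP xC.
  by exists (fun D => (D == C)%:R); apply: certifies_tight.
rewrite active_zero => /eqP xk; exists (fun=> 0).
split=> // i; rewrite /cover big1 //=; first by rewrite oppr_le0.
by move=> xi; case: eqP xi => [->|]; rewrite ?xk ?ltxx ?oppr0.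
Qed.

(** Otherwise Farkas' lemma yields a feasible direction that increases the objective. *)
Lemma certified_weights : exists nu, certifies w nu.
Proof.
have [/cone_active_certified //|[d [ad wd]]] := farkas gradient active w.
have [t t0 /x_opt.2] := feasible_direction ad.
have -> : \sum_i w i * [ffun i => x i + t * d i] i =
          \sum_i w i * x i + t * dot w d.
  by rewrite /dot mulr_sumr -big_split; apply: eq_bigr => i _; rewrite ffunE /=; ring.
by rewrite gerDl leNgt mulr_gt0.
Qed.

Lemma certified_value b nu :
  certifies b nu -> \sum_C nu C = \sum_i b i * x i.
Proof.
case=> nu0 nuT nub nue; transitivity (\sum_C nu C * load x C).
  apply: eq_bigr => C _; have [->|/nuT->] := eqVneq (load x C) 1.
    by rewrite mulr1.
  by rewrite mul0r.
rewrite sum_load_cover; apply: eq_bigr => i _; rewrite mulrC.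
have [xi|] := ltP 0 (x i); first by rewrite nue.
move=> xi; have /le_anti -> : x i <= 0 <= x i by rewrite xi x_ge0.
by rewrite !mulr0.
Qed.

Lemma certified_optimal nu :
  certifies w nu -> dual_optimal w [ffun C => nu C].
Proof.
move=> cw; have [nu0 _ nuw _] := cw; split=> [|mu [mu0 muw]].
  split=> [C|i]; first by rewrite ffunE.
  by under eq_bigr do rewrite ffunE; apply: nuw.
under eq_bigr do rewrite ffunE.
rewrite (certified_value cw).
by have /andP[h1 h2] := weak_duality x_ge0 load_x mu0 muw; apply: le_trans h1 h2.
Qed.

Section Complementary.
Variable mu : {ffun clique e -> R}.
Hypothesis mu_opt : dual_optimal w mu.

(** A certificate for [w] is dual feasible and has the primal optimal value; [mu] does no worse, so
    both inequalities of [weak_duality] collapse. *)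
Lemma strong_duality : \sum_C mu C = \sum_C mu C * load x C /\
  \sum_i w i * x i = \sum_C mu C * load x C.
Proof.
have [nu cw] := certified_weights.
have [[mu0 muw] /(_ _ (certified_optimal cw).1)] := mu_opt.
under [X in _ <= X]eq_bigr do rewrite ffunE.
rewrite (certified_value cw).
have /andP[h1 h2] := weak_duality x_ge0 load_x mu0 muw.
move=> h3; split; apply/le_anti/andP; split => //.
  exact: le_trans h1.
exact: le_trans h3.
Qed.

Lemma dual_support_tight C : 0 < mu C -> load x C = 1.
Proof.
move=> muC; apply/le_anti; rewrite load_x /= leNgt; apply/negP => xC.
have [[[mu0 _] _] [/eqP + _]] := (mu_opt, strong_duality).
apply/negP; rewrite gt_eqF //.
rewrite (bigD1 C) //= [X in _ < X](bigD1 C) //=; apply: ltr_leD.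
  by rewrite -[ltRHS]mulr1 ltr_pM2l.
by apply: ler_sum => D _; rewrite -[leRHS]mulr1 ler_wpM2l.
Qed.

Lemma primal_support_tight i : 0 < x i -> cover mu i = w i.
Proof.
move=> xi; have [[[_ muw] _] [_ /eqP]] := (mu_opt, strong_duality).
rewrite sum_load_cover => h; apply/le_anti; rewrite muw andbT leNgt.
apply/negP => wi; move: h; apply/negP; rewrite lt_eqF //.
rewrite (bigD1 i) //= [X in _ < X](bigD1 i) //=; apply: ltr_leD.
  by rewrite mulrC ltr_pM2l.
by apply: ler_sum => k _; rewrite mulrC ler_wpM2l // muw.
Qed.

End Complementary.
End Optimum.

(* If no optimal dual solution is positive at [C], Farkas' lemma gives a direction
   from [x] along which optimality is preserved and the load of [C] decreases;
   relative interiority allows a step backwards, which overloads [C]. *)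
Lemma strictly_complementary (x : {ffun N -> R}) mu C :
    relint (primal_optimal e w) x -> relint (dual_optimal w) mu ->
  load x C = 1 -> 0 < mu C.
Proof.
move=> x_int mu_int xC; have [x_opt mu_opt] := (x_int.1, mu_int.1).
(* [None] stands for the generator [- w]: the question is whether [t * w - 1_C] lies in the active
   cone for some [t >= 0]. *)
pose a j := if j is Some j' then gradient j' else fun i => - w i.
pose b i := - gradient (inl C) i.
have [cb|[d [ad bd]]] := farkas a (None :: map Some (active x)) b.
  have [t t0 cb'] := cb.
  have {}cb' : cone gradient (active x) (fun i => b i + t * w i).
    have : cone a (map Some (active x)) (fun i => b i + t * w i).
      by apply: eq_cone cb' => i; rewrite /a; ring.
    elim: (active x) (fun i => b i + t * w i) => [//|j s IH] u /= [t' t'0 h].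
    by exists t' => //; apply: IH.
  have [nu1 c1] := cone_active_certified cb'.
  have [nu2 c2] := certified_weights x_opt.
  (* Adding certificates for [1_C] and [w] to one for [t * w - 1_C] certifies [(1 + t) * w] with a
     positive value at [C]; the extra [w] keeps the factor nonzero when [t = 0]. *)
  have c3 := certifiesDZ ler01 (certifiesDZ ler01 c1 (certifies_tight xC)) c2.
  have t1 : 0 < 1 + t by rewrite ltr_pwDl.
  have it : 0 <= (1 + t)^-1 by rewrite invr_ge0 ltW.
  pose nu D := 0 + (1 + t)^-1 * (nu1 D + 1 * (D == C)%:R + 1 * nu2 D).
  have cw : certifies x w nu.
    apply: eq_certifies (certifiesDZ it (certifies0 x) c3) => i.
    by rewrite /b; field; rewrite gt_eqF.
  have nuC : 0 < nu C.
    rewrite /nu eqxx; have [[nu1_0 _ _ _] [nu2_0 _ _ _]] := (c1, c2).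
    by rewrite add0r mulr_gt0 ?invr_gt0 // !mul1r -addrA addrCA ltr_pwDl // addr_ge0.
  (* If [mu C] were zero, moving from [nu] past [mu] would make the coordinate at [C] negative. *)
  have [r r0 [[+ _] _]] := relint_extend mu_int (certified_optimal x_opt cw).
  move=> /(_ C); rewrite !ffunE.
  have muC : 0 <= mu C by case: mu_opt => -[].
  move=> h; rewrite lt0r muC andbT; apply/eqP => mu0; move: h.
  by rewrite mu0 add0r sub0r mulrN oppr_ge0 leNgt mulr_gt0.
have d1 j : j \in active x -> dot (gradient j) d <= 0.
  by move=> jx; apply: (ad (Some j)); rewrite inE map_f.
have wd : 0 <= dot w d.
  have := ad None (mem_head _ _); rewrite /dot -oppr_ge0 -sumrN.
  by under eq_bigr do rewrite mulNr opprK.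
have dC : load d C < 0.
  move: bd; rewrite -[load d C](dot_gradient (inl C)) -oppr_gt0 /dot -sumrN.
  by under [X in _ -> _ < X]eq_bigr do rewrite -mulNr.
have [t t0 fy] := feasible_direction x_opt d1.
have oy : primal_optimal e w [ffun i => x i + t * d i].
  split=> // z /x_opt.2 h; apply: le_trans h _.
  rewrite (_ : \sum_i w i * [ffun i => x i + t * d i] i =
          \sum_i w i * x i + t * dot w d); first by rewrite lerDl mulr_ge0 // ltW.
  by rewrite /dot mulr_sumr -big_split; apply: eq_bigr => i _; rewrite ffunE /=; ring.
have [r r0 [[_ /(_ C) +] _]] := relint_extend x_int oy.
have -> : \sum_(i in val C) [ffun i => x i + r * (x i - [ffun i => x i + t * d i] i)] i
    = load x C + - (r * t) * load d C.
  by rewrite -loadDZ; apply: eq_bigr => i _; rewrite !ffunE; ring.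
by rewrite xC gerDl mulNr oppr_le0 leNgt nmulr_llt0 // mulr_gt0.
Qed.

End Duality.

(** * The rounding loop *)

Section Loop.
Variables (R : realType) (N : finType) (e : rel N) (w : N -> R).
Variable mu : {ffun clique e -> R}.
Hypothesis e_sym : symmetric e.
Hypothesis e_irr : irreflexive e.
Hypothesis mu_feas : dual_feasible w mu.
Implicit Types (C : clique e) (I J S T : {set N}).

Let mu_ge0 C : 0 <= mu C. Proof. by case: mu_feas. Qed.
Let w_cover i : w i <= cover mu i. Proof. by case: mu_feas. Qed.

Lemma stableP S : reflect {in S &, forall i j, ~~ e i j} (stable e S).
Proof.
apply: (iffP idP) => [/forall_inP h i j iS jS|h].
  by have /forall_inP := h i iS; apply.
by apply/forall_inP => i iS; apply/forall_inP => j jS; apply: h.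
Qed.

Lemma complete_onP S :
  reflect {in S &, forall i j, i != j -> e i j} (complete_on e S).
Proof.
apply: (iffP idP) => [/forall_inP h i j iS jS|h].
  by have /forall_inP/(_ j jS)/implyP := h i iS; apply.
by apply/forall_inP => i iS; apply/forall_inP => j jS; apply/implyP; apply: h.
Qed.

Lemma cliqueE C : {in val C &, forall i j, i != j -> e i j}.
Proof. by apply/complete_onP; case/andP: (valP C). Qed.

Lemma stable_sub S T : T \subset S -> stable e S -> stable e T.
Proof. by move=> /subsetP TS /stableP h; apply/stableP => i j /TS iS /TS; apply: h. Qed.

Definition meets C I := val C :&: I != set0.

Lemma clique_meetsP C I : reflect (exists2 i, i \in val C & i \in I) (meets C I).
Proof.
apply: (iffP (set0Pn _)) => [[i /setIP[]]|[i iC iI]]; first by exists i.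
by exists i; rewrite inE iC.
Qed.

Lemma meetsS C I J : I \subset J -> meets C I -> meets C J.
Proof.
by move=> /subsetP IJ /clique_meetsP[i iC /IJ iJ]; apply/clique_meetsP; exists i.
Qed.

Lemma meets0 C : meets C set0 = false.
Proof. by rewrite /meets setI0 eqxx. Qed.

Lemma card_clique_stable C T : stable e T -> (#|val C :&: T| <= meets C T)%N.
Proof.
move=> /stableP sT; rewrite /meets; have [->|_] := eqVneq; first by rewrite cards0.
apply/card_le1_eqP => i j /setIP[iC iT] /setIP[jC jT].
by apply: (contraNeq _ (sT i j iT jT)); rewrite eq_sym; apply: cliqueE iC jC.
Qed.

Lemma sum_cover T : \sum_(i in T) cover mu i = \sum_C mu C * #|val C :&: T|%:R.
Proof.
transitivity (\sum_i (i \in T)%:R * cover mu i).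
  by rewrite big_mkcond; apply: eq_bigr => i _; case: ifP; rewrite ?mul1r ?mul0r.
rewrite -sum_load_cover; apply: eq_bigr => C _; congr (_ * _).
rewrite -sum1_card natr_sum /load big_mkcond [RHS]big_mkcond.
by apply: eq_bigr => i _; rewrite inE; case: (i \in val C); case: (i \in T).
Qed.

Lemma VLPE I : VLP mu I = \sum_C mu C * (meets C I)%:R.
Proof.
rewrite /VLP big_mkcond; apply: eq_bigr => C _.
by rewrite /meets; case: ifP; rewrite ?mulr1 ?mulr0.
Qed.

Lemma VLP_set0 : VLP mu set0 = 0.
Proof. by rewrite VLPE big1 // => C _; rewrite meets0 mulr0. Qed.

(** Weak duality confined to [I]: a stable set meets each clique at most once. *)
Lemma weight_le_VLP T I :
  stable e T -> T \subset I -> \sum_(i in T) w i <= VLP mu I.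
Proof.
move=> sT TI; apply: (@le_trans _ _ (\sum_(i in T) cover mu i)).
  by apply: ler_sum => i _.
rewrite sum_cover VLPE; apply: ler_sum => C _; rewrite ler_wpM2l // ler_nat.
apply: leq_trans (card_clique_stable C sT) _.
by case: (boolP (meets C T)) => // /(meetsS TI) ->.
Qed.

Variable I0 : {set N}.
Hypothesis I0_tight : {in I0, forall i, cover mu i = w i}.

Definition transversal I T :=
  forall C, 0 < mu C -> meets C I -> meets C T.

Definition hittable I : Prop :=
  exists T, [/\ T \subset I, stable e T & transversal I T].

(* Every nonempty trace on [I] of a clique of positive dual value is a maximal
   clique of the subgraph induced by [I]. *)
Definition clean I : Prop :=
  forall C j, 0 < mu C -> meets C I -> j \in I -> j \notin val C ->
  exists z, [/\ z \in val C, z \in I & ~~ e j z].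

(** On [I0] weights equal covers, and [T] counts every positive clique meeting [I] at least once. *)
Lemma VLP_le_weight I T :
  T \subset I0 -> transversal I T -> VLP mu I <= \sum_(i in T) w i.
Proof.
move=> /subsetP TI0 trT.
rewrite -(eq_bigr _ (fun i iT => I0_tight (TI0 i iT))) sum_cover VLPE.
apply: ler_sum => C _.
have := mu_ge0 C; rewrite le_eqVlt => /predU1P[<-|muC]; first by rewrite !mul0r.
rewrite ler_pM2l // ler_nat; case: (boolP (meets C I)) => // /(trT C muC).
by rewrite /meets -card_gt0.
Qed.

Definition closed_nbhd j := j |: nbhd e j.

Lemma in_closed_nbhd j z : (z \in closed_nbhd j) = (z == j) || e j z.
Proof. by rewrite !inE. Qed.

Lemma VLP_drop I j :
  VLP mu I - VLP mu (I :\: closed_nbhd j) =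
  \sum_C mu C * (meets C I && ~~ meets C (I :\: closed_nbhd j))%:R.
Proof.
rewrite !VLPE -sumrB; apply: eq_bigr => C _; rewrite -mulrBr; congr (_ * _).
case: (boolP (meets C (I :\: _))) => [|_] /=; last by rewrite andbT subr0.
by move/(meetsS (subsetDl _ _)) ->; rewrite subrr.
Qed.

Lemma cover_sum j : cover mu j = \sum_C mu C * (j \in val C)%:R.
Proof.
by rewrite /cover big_mkcond; apply: eq_bigr => C _; case: ifP; rewrite ?mulr1 ?mulr0.
Qed.

Lemma meets_outside C I j :
  reflect (forall z, z \in val C -> z \in I -> (z == j) || e j z)
    (~~ meets C (I :\: closed_nbhd j)).
Proof.
apply: (iffP idP) => [|h].
  move/clique_meetsP=> h z zC zI; apply: contra_notT h => zj; exists z => //.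
  by rewrite inE in_closed_nbhd zj.
apply/clique_meetsP => -[z zC /setDP[zI]]; rewrite in_closed_nbhd; apply/negP.
by rewrite negbK h.
Qed.

(** The cliques through [j] have total value [w j]; a drop of [VLP] beyond this loses a positive
    clique avoiding [j], whose trace then consists of neighbours of [j]. *)
Lemma removable_witness I j : I \subset I0 -> removable e w (VLP mu) I j ->
  exists C, [/\ 0 < mu C, meets C I, j \notin val C &
     forall z, z \in val C -> z \in I -> e j z].
Proof.
move=> II0 /andP[jI]; rewrite -/(closed_nbhd j) VLP_drop.
rewrite -I0_tight ?(subsetP II0) // cover_sum => lt.
have [/existsP[C /and4P[muC CI jC /meets_outside Cj]]|none] := boolP [exists C,
  [&& 0 < mu C, meets C I, j \notin val C & ~~ meets C (I :\: closed_nbhd j)]].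
  exists C; split=> // z zC zI; have /orP[/eqP zj|//] := Cj z zC zI.
  by rewrite -zj zC in jC.
move: lt; rewrite ltNge => /negP[]; apply: ler_sum => C _.
have := mu_ge0 C; rewrite le_eqVlt => /predU1P[<-|muC]; first by rewrite !mul0r.
rewrite ler_pM2l // ler_nat; move/existsPn/(_ C): none; rewrite muC /=.
by case: (meets C I); case: (j \in val C); case: (meets C _).
Qed.

(** The cliques through [j] are all lost with its closed neighbourhood and already account for
    [w j], so one more lost positive clique would make [j] removable. *)
Lemma irremovable_clean I : I \subset I0 ->
  (forall j, ~~ removable e w (VLP mu) I j) -> clean I.
Proof.
move=> II0 h C j muC CI jI jC.
have [/existsP[z /and3P[]]|none] :=
  boolP [exists z, [&& z \in val C, z \in I & ~~ e j z]].
  by exists z.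
have out : ~~ meets C (I :\: closed_nbhd j).
  apply/meets_outside => z zC zI; apply/orP; right.
  by move/existsPn/(_ z): none; rewrite zC zI negbK.
have := h j; rewrite /removable jI -/(closed_nbhd j) VLP_drop -leNgt.
rewrite -I0_tight ?(subsetP II0) // cover_sum leNgt => /negP[].
rewrite (bigD1 C) //= [ltRHS](bigD1 C) //= CI out (negPf jC) mulr0 mulr1.
apply: ltr_leD => //; apply: ler_sum => D _; rewrite ler_wpM2l // ler_nat.
case: (boolP (j \in val D)) => // jD; rewrite (_ : _ && _) //.
have -> : meets D I by apply/clique_meetsP; exists j.
apply/meets_outside => z zD _; rewrite orbC; case: eqVneq; rewrite ?orbT // => zj.
by rewrite orbF; apply: (@cliqueE D); rewrite // eq_sym.
Qed.

(** [T] meets the witness clique of a removable [j] at a neighbour of [j]; being stable, it does not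
    contain [j]. *)
Lemma prune_transversal T J J' : prune e w (VLP mu) J J' ->
    J \subset I0 -> T \subset J -> stable e T -> transversal J T ->
  T \subset J'.
Proof.
elim=> // {}J j {}J' rj _ IH JI0 TJ sT trT.
have [C [muC CJ jC Cj]] := removable_witness JI0 rj.
have jT : j \notin T.
  apply/negP => jT; have /clique_meetsP[z zC zT] := trT C muC CJ.
  by have /stableP/(_ j z jT zT) := sT; rewrite Cj // (subsetP TJ).
apply: IH => //.
- by apply: subset_trans (subsetDl _ _) JI0.
- by rewrite subsetD1 TJ.
- by move=> D muD /(meetsS (subsetDl _ _)); apply: trT.
Qed.

Lemma prune_clean J J' :
  prune e w (VLP mu) J J' -> J \subset I0 -> clean J'.
Proof.
elim=> [{}J h JI0|{}J j {}J' _ _ IH JI0]; first exact: irremovable_clean.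
by apply: IH; apply: subset_trans (subsetDl _ _) JI0.
Qed.

(** [T :\ i] survives the pruning, so [VLP mu I <= w(T) = w i + w(T :\ i) <= w i + VLP mu I']. *)
Lemma good_choice T I I' i : I \subset I0 ->
    T \subset I -> stable e T -> transversal I T -> i \in T ->
    prune e w (VLP mu) (I :\: closed_nbhd i) I' ->
  VLP mu I <= VLP mu I' + w i.
Proof.
move=> II0 TI sT trT iT pI'; have /stableP sT' := sT.
have TI' : T :\ i \subset I'.
  apply: prune_transversal pI' _ _ _ _.
  - by apply: subset_trans (subsetDl _ _) II0.
  - apply/subsetP => z /setD1P[zi zT]; rewrite inE in_closed_nbhd negb_or zi.
    by rewrite sT' // (subsetP TI).
  - by apply: stable_sub sT; apply: subsetDl.
  (* A clique met by [T] at [i] lies in the closed neighbourhood of [i] and no longer meets the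
     state. *)
  move=> C muC mC; have /clique_meetsP[z zC zT] := trT C muC (meetsS (subsetDl _ _) mC).
  apply/clique_meetsP; exists z; rewrite // !inE zT andbT; apply/eqP => zi.
  move: mC; apply/negP; apply/meets_outside => y yC _.
  by case: eqVneq => //= yi; rewrite (@cliqueE C) -?zi // zi eq_sym.
apply: le_trans (VLP_le_weight (subset_trans TI II0) trT) _.
rewrite (big_setD1 i) //= addrC lerD2r; apply: weight_le_VLP => //.
by apply: stable_sub sT; apply: subsetDl.
Qed.

Lemma stable_setU1 i S :
  stable e S -> (forall s, s \in S -> ~~ e s i) -> stable e (i |: S).
Proof.
move=> /stableP sS Si; apply/stableP => a b /setU1P[->|aS] /setU1P[->|bS].
- by rewrite e_irr.
- by rewrite e_sym Si.
- exact: Si.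
- exact: sS.
Qed.

(** [J0] limits the clean sets to be treated: the co-unipolar case enters this loop only after its
    first choice, inside a bipartite graph. *)
Lemma phase2_mwss J0 st T : J0 \subset I0 ->
    (forall I, I \subset J0 -> clean I -> hittable I) ->
    phase2 e w (VLP mu) st T ->
    st.1 \subset J0 -> hittable st.1 -> stable e st.2 ->
    (forall s v, s \in st.2 -> v \in st.1 -> (s != v) && ~~ e s v) ->
    \sum_C mu C <= \sum_(i in st.2) w i + VLP mu st.1 ->
  mwss e w T.
Proof.
move=> J0I0 clean_hit; elim=> {st T} [S|i [I S] st' T it _ IH] /=.
  move=> _ _ sS _; rewrite VLP_set0 addr0 => le; split=> // T sT.
  apply: le_trans le; apply: le_trans (weight_le_VLP sT (subsetT T)) _.
  rewrite VLPE; apply: ler_sum => C _; rewrite -[leRHS]mulr1.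
  by rewrite ler_wpM2l // lern1 leq_b1.
move=> IJ0 hitI sS SI le.
case: it => /= iI [I' pI' st'E].
have II0 := subset_trans IJ0 J0I0.
have I'D := prune_sub pI'; have I'I := subset_trans I'D (subsetDl _ _).
(* If [i] is rejected, [good_choice] puts it outside the transversal [U]; so [U] survives in
   [I :\ i], and its weight shows that [VLP] does not drop. *)
have [ge|lt] := leP (VLP mu I) (VLP mu I' + w i); last first.
  rewrite lt in st'E.
  have [U [UI sU trU]] := hitI.
  have iU : i \notin U.
    apply/negP => iU; have := good_choice II0 UI sU trU iU pI'.
    by rewrite leNgt lt.
  have UIi : U \subset I :\ i by rewrite subsetD1 UI.
  rewrite st'E in IH; apply: IH => //=.
  - by apply: subset_trans (subsetDl _ _) IJ0.
  - by exists U; split=> // C muC /(meetsS (subsetDl _ _)); apply: trU.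
  - by move=> s v sS' /setD1P[_ vI]; apply: SI.
  apply: le_trans le _; rewrite lerD2l; apply: le_trans (VLP_le_weight _ trU) _.
    exact: subset_trans UI II0.
  exact: weight_le_VLP.
(* If [i] is accepted, the pruned state is clean, hence hittable, and the look-ahead test is the
   inequality that preserves the bound. *)
rewrite ltNge ge /= in st'E; rewrite st'E in IH; apply: IH => /=.
- exact: subset_trans I'I IJ0.
- apply: clean_hit; first exact: subset_trans I'I IJ0.
  by apply: prune_clean pI' _; apply: subset_trans (subsetDl _ _) II0.
- by apply: stable_setU1 => // s sS'; case/andP: (SI s i sS' iI).
- move=> s v /setU1P[->|sS'] vI'; last by rewrite SI // (subsetP I'I).
  have /setDP[_] := subsetP I'D v vI'.
  by rewrite in_closed_nbhd negb_or eq_sym.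
have iS : i \notin S by apply/negP => /SI/(_ iI); rewrite eqxx.
rewrite big_setU1 //=; apply: le_trans le _.
by rewrite -addrA addrCA lerD2l addrC.
Qed.

End Loop.

(** * Simplicial vertices of chordal graphs *)

Section Chordal.
Variables (N : finType) (e : rel N).
Hypothesis e_sym : symmetric e.
Hypothesis e_irr : irreflexive e.
Implicit Types (I S T : {set N}) (p q c : seq N).

Lemma next_index c x y : uniq c -> x \in c -> y \in c ->
  (y == next c x) = (index y c == (index x c).+1)
                 || ((index x c).+1 == size c) && (index y c == 0%N).
Proof.
case: c => // c0 c Uc xc yc; rewrite next_nth xc.
set k := index x (c0 :: c); set l := index y (c0 :: c).
have yE : y = nth c0 (c0 :: c) l by rewrite nth_index.
have lt_l : (l < size (c0 :: c))%N by rewrite index_mem.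
have lt_k : (k < size (c0 :: c))%N by rewrite index_mem.
rewrite [in LHS]yE (_ : nth c0 c k = nth c0 (c0 :: c) k.+1) //.
have [lt|ge] := ltnP k.+1 (size (c0 :: c)).
  by rewrite nth_uniq // (ltn_eqF lt) /= orbF.
have kE : k.+1 = size (c0 :: c) by apply/eqP; rewrite eqn_leq ge lt_k.
rewrite (nth_default _ ge) kE eqxx (ltn_eqF lt_l) /=.
by rewrite -(nth_uniq c0 lt_l (ltn0Sn _) Uc).
Qed.

(** Induced paths, built from the front so that [chordless_cons] can prepend a vertex and
    shortcut. *)
Fixpoint chordless (x : N) p : bool :=
  if p is y :: p' then
    [&& e x y, all (fun z => (z != x) && ~~ e x z) p' & chordless y p']
  else true.

(** The new path jumps from [x] to the last vertex of [y :: q] that is adjacent to [x], or restarts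
    there if that last vertex is [x] itself. *)
Lemma chordless_cons x y q : chordless y q ->
    has (fun z => (z == x) || e x z) (y :: q) ->
  exists q', [/\ chordless x q', last x q' = last y q & {subset q' <= y :: q}].
Proof.
elim: q y => [|y2 q IH] y.
  rewrite /= orbF => _ /orP[/eqP->|xy]; first by exists [::].
  by exists [:: y]; split; rewrite /= ?xy.
move=> /[dup] cq /and3P[yy2 _ /IH{}IH].
have [/IH[q' [h1 h2 h3]] _|nh] := boolP (has (fun z => (z == x) || e x z) (y2 :: q)).
  by exists q'; split=> // z /h3; rewrite !inE => ->; rewrite orbT.
rewrite [has _ _](_ : _ = (y == x) || e x y); last by rewrite -[RHS]orbF -(negPf nh).
case/orP=> [/eqP yx|xy].
  by exists (y2 :: q); rewrite -yx; split=> // z zq; rewrite inE zq orbT.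
exists [:: y, y2 & q]; split=> //.
rewrite [chordless _ _]/= -/(chordless y (y2 :: q)) xy cq andbT.
by move: nh; rewrite -all_predC; apply: sub_all => z /=; rewrite negb_or.
Qed.

Lemma path_chordless x p : path e x p ->
  exists q, [/\ chordless x q, last x q = last x p & {subset q <= p}].
Proof.
elim: p x => [|y p IH] x /=; first by exists [::].
case/andP=> xy /IH[q [cq <- sq]].
case: (@chordless_cons x y q cq) => [|q' [h1 h2 h3]]; first by rewrite /= xy orbT.
exists q'; split=> // z /h3; rewrite !inE => /predU1P[->|/sq->].
  by rewrite eqxx.
by rewrite orbT.
Qed.

Lemma chordless_uniq x p : chordless x p -> uniq (x :: p).
Proof.
elim: p x => [|y p IH] x //= /and3P[xy /allP xp /IH]; rewrite /= => ->.
rewrite andbT inE negb_or; apply/andP; split.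
  by apply: contraTneq xy => ->; rewrite e_irr.
by apply/negP => /xp; rewrite eqxx.
Qed.

Lemma chordless_adjacency x p : chordless x p ->
  {in x :: p &, forall a b, e a b =
     (index b (x :: p) == (index a (x :: p)).+1) ||
     (index a (x :: p) == (index b (x :: p)).+1)}.
Proof.
elim: p x => [|y p IH] x cp a b.
  by rewrite !inE => /eqP-> /eqP->; rewrite e_irr /= eqxx.
have Uxp := chordless_uniq cp.
have [xy /allP xp /IH{}IH] := and3P cp.
have x_edge z : z \in y :: p -> e x z = (index z (y :: p) == 0%N).
  rewrite inE => /predU1P[->|zp]; first by rewrite /= eqxx.
  have /andP[_ /negPf->] := xp z zp; rewrite /=.
  by case: (eqVneq y z) => // yz; move: Uxp; rewrite /= yz zp /= andbF.
have idx z : z \in y :: p -> index z [:: x, y & p] = (index z (y :: p)).+1.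
  move=> zp; rewrite /=; case: eqVneq => // xz.
  by move: Uxp; rewrite [uniq _]/= -/(uniq (y :: p)) xz zp.
have idx0 : index x [:: x, y & p] = 0%N by rewrite /= eqxx.
rewrite inE => /predU1P[->|ap]; rewrite inE => /predU1P[->|bp].
- by rewrite e_irr idx0.
- by rewrite idx0 idx // x_edge // eqSS orbF.
- by rewrite e_sym idx0 idx // x_edge // eqSS.
- by rewrite !idx // !eqSS IH.
Qed.

Lemma chordless_induced_cycle u s p :
    chordless s p -> u \notin s :: p -> (1 < size p)%N ->
    {in s :: p, forall z, e u z = (z == s) || (z == last s p)} ->
  induced_cycle e [:: u, s & p].
Proof.
move=> cp up sp ue; have Up := chordless_uniq cp.
have Uc : uniq [:: u, s & p] by rewrite [uniq _]/= -/(uniq (s :: p)) up Up.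
split=> // a b ac bc; rewrite !next_index //.
have idx0 : index u [:: u, s & p] = 0%N by rewrite /= eqxx.
have idx z : z \in s :: p -> index z [:: u, s & p] = (index z (s :: p)).+1.
  by move=> zp; rewrite /=; case: eqVneq => // uz; rewrite uz zp in up.
have u_edge z : z \in s :: p ->
    e u z = (index z (s :: p) == 0%N) || (index z (s :: p) == size p).
  move=> zp; rewrite ue //; congr orb.
    by rewrite /= eq_sym; case: eqP.
  have lp : last s p \in s :: p by apply: mem_last.
  rewrite -(index_last Up); apply/eqP/eqP => [->//|h].
  by rewrite -(nth_index s zp) h nth_index.
move: ac bc; rewrite inE => /predU1P[->|ap]; rewrite inE => /predU1P[->|bp].
- by rewrite e_irr idx0.
- by rewrite idx0 idx // u_edge //= !eqSS andbT orbF.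
- by rewrite e_sym idx0 idx // u_edge //= !eqSS andbT orbF orbC.
- by rewrite !idx // !eqSS !andbF !orbF (chordless_adjacency cp).
Qed.

Definition simplicial I v : Prop :=
  {in I &, forall y z, e v y -> e v z -> y != z -> e y z}.

Hypothesis e_chordal : chordal e.

(** Were [s] and [t] nonadjacent, a chordless path between them with interior in [W] would close up
    with [u] to an induced cycle of length at least 4. *)
Lemma common_nbrs_adjacent u s t (W : {set N}) :
    (forall z, z \in W -> (z != u) && ~~ e u z) -> e u s -> e u t -> s != t ->
    connect (induced e (s |: (t |: W))) s t ->
  e s t.
Proof.
move=> Wu us ut st /connectP[p pP tE].
have pe : path e s p by apply: sub_path pP => a b /and3P[].
have pB : {subset p <= s |: (t |: W)}.
  move=> z; elim: p {tE pe} (s in path _ s) pP => //= y p IH x /andP[/and3P[_ yB _] pp].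
  by rewrite inE => /predU1P[->//|]; apply: IH pp.
have [q [cq lq sq]] := path_chordless pe.
rewrite -tE in lq; apply: contraT => nst.
have qB z : z \in s :: q -> z \in s |: (t |: W).
  by rewrite inE => /predU1P[->|/sq/pB//]; rewrite setU11.
(* Fewer than four vertices leave only [q = [:: t]], whose chordlessness gives the edge. *)
suff: (size [:: u, s & q] < 4)%N.
  case: q cq lq {sq qB} => [|y [|y' q]] //=.
    by move=> _ ts; rewrite ts eqxx in st.
  by rewrite andbT => /[swap] ->; rewrite (negPf nst).
have su z : e u z -> z != u by apply: contraTneq => ->; rewrite e_irr.
apply: e_chordal; apply: chordless_induced_cycle => //.
- apply/negP => /qB /setU1P[us'|/setU1P[ut'|/Wu]]; last by rewrite eqxx.
    by have := su s us; rewrite us' eqxx.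
  by have := su t ut; rewrite ut' eqxx.
- case: q cq lq {sq qB} => [|y [|y' q]] //=.
    by move=> _ ts; rewrite ts eqxx in st.
  by rewrite andbT => /[swap] ->; rewrite (negPf nst).
move=> z /qB; rewrite lq => /setU1P[->|/setU1P[->|/Wu/andP[_ nuz]]].
- by rewrite us eqxx.
- by rewrite ut eqxx orbT.
rewrite (negPf nuz); apply/esym/negbTE; rewrite negb_or.
by apply/andP; split; apply: contraNneq nuz => ->.
Qed.

(* Dirac's argument: [S] is the set of neighbours of a component [M] of
   [I :\: closed_nbhd u]. Since [S] lies in the neighbourhood of [u], two
   nonadjacent vertices of [S] would span with [u] and a shortest path through
   [M] an induced cycle of length at least 4; so [S] is complete, and the
   smaller set [M :|: S] provides a simplicial vertex in [M]. *)
Lemma simplicial_away I u z : u \in I -> z \in I -> z != u -> ~~ e u z ->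
  exists v, [/\ v \in I, v != u, ~~ e u v & simplicial I v].
Proof.
have [n] := ubnP #|I|; elim: n I u z => // n IH I u m0 leI uI m0I m0u num0.
pose W := [set z in I | (z != u) && ~~ e u z].
have WP z : z \in W -> (z != u) && ~~ e u z by rewrite inE => /andP[].
have WI z : z \in W -> z \in I by rewrite inE => /andP[].
have m0W : m0 \in W by rewrite inE m0I m0u.
pose M := [set m in W | connect (induced e W) m0 m].
have MW m : m \in M -> m \in W by rewrite inE => /andP[].
have m0M : m0 \in M by rewrite inE m0W connect0.
pose S := [set s in I | e u s && [exists m in M, e m s]].
have symW : connect_sym (induced e W).
  by apply: sym_connect_sym => a b; rewrite /induced /= andbCA e_sym.
have S_complete s t : s \in S -> t \in S -> s != t -> e s t.
  rewrite !inE => /and3P[_ us /exists_inP[ms msM mss]].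
  case/and3P=> _ ut /exists_inP[mt mtM mtt] st.
  apply: (common_nbrs_adjacent WP us ut st); set B := s |: (t |: W).
  have WB z : z \in W -> z \in B by move=> zW; rewrite /B !setU1r.
  have sB : s \in B by rewrite setU11.
  have tB : t \in B by rewrite /B setU1r ?setU11.
  apply: (@connect_trans _ _ ms); last apply: (@connect_trans _ _ mt).
  - by apply: connect1; rewrite /induced /= sB WB ?MW //= e_sym.
  - apply: (@connect_sub _ (induced e W)) => [a b /and3P[aW bW ab]|].
      by apply: connect1; rewrite /induced /= !WB.
    move: msM mtM; rewrite !inE => /andP[_ c1] /andP[_ c2].
    by apply: connect_trans c2; rewrite symW.
  - by apply: connect1; rewrite /induced /= tB WB ?MW.
have nbM m y : m \in M -> y \in I -> e m y -> y \in M :|: S.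
  move=> mM yI my; have /andP[mu num] := WP m (MW m mM).
  apply/setUP; have [uy|nuy] := boolP (e u y).
    by right; rewrite inE yI uy; apply/exists_inP; exists m.
  have yu : y != u by apply: contraNneq num => <-; rewrite e_sym.
  have yW : y \in W by rewrite inE yI yu.
  have c : connect (induced e W) m0 m by move: mM; rewrite inE => /andP[].
  left; rewrite inE yW; apply: connect_trans c (connect1 _).
  by rewrite /induced /= MW ?yW.
have uJ : u \notin M :|: S.
  by rewrite !inE eqxx /= !andbF /= e_irr andbF.
have JI : M :|: S \subset I.
  by apply/subsetP => z /setUP[/MW/WI//|]; rewrite inE => /andP[].
have ltJ : (#|M :|: S| < n)%N.
  rewrite -ltnS; apply: leq_trans leI; rewrite ltnS.
  apply: proper_card; apply/properP; split=> //.
  by exists u.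
suff [m mM sm] : exists2 m, m \in M & simplicial (M :|: S) m.
  have /andP[mu num] := WP m (MW m mM).
  exists m; split=> //; first exact: WI (MW m mM).
  by move=> y z yI zI my mz; apply: sm => //; apply: nbM mM _ _.
(* If some [s] in [S] has a nonneighbour in [M :|: S], induction around [s] gives a simplicial
   vertex not adjacent to [s], hence outside the complete set [S]. *)
have [/exists_inP[s sS /exists_inP[z zJ /andP[zs nsz]]]|univ] := boolP
    [exists s in S, [exists z in M :|: S, (z != s) && ~~ e s z]].
  have sJ : s \in M :|: S by rewrite inE sS orbT.
  have [v [vJ vs nsv sv]] := IH _ s z ltJ sJ zJ zs nsz.
  exists v => //; case/setUP: vJ => // vS; case/negP: nsv.
  by apply: S_complete => //; rewrite eq_sym.
have {}univ s z : s \in S -> z \in M :|: S -> z != s -> e s z.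
  move=> sS zJ zs; apply: contraNT univ => nsz.
  by apply/exists_inP; exists s => //; apply/exists_inP; exists z; rewrite ?zs.
(* Now each vertex of [S] is adjacent to all others of [M :|: S], so being simplicial in [M]
   suffices. *)
suff [m mM sm] : exists2 m, m \in M & simplicial M m.
  exists m => // y z /setUP[yM|yS] /setUP[zM|zS] my mz yz.
  - exact: sm.
  - by rewrite e_sym univ //; apply/setUP; left.
  - by apply: univ; rewrite // 1?eq_sym //; apply/setUP; left.
  - exact: S_complete.
have [/exists_inP[a aM /exists_inP[z zM /andP[za naz]]]|compl] := boolP
    [exists a in M, [exists z in M, (z != a) && ~~ e a z]].
  have ltM : (#|M| < n)%N.
    by apply: leq_ltn_trans ltJ; rewrite subset_leq_card ?subsetUl.
  by have [v [vM _ _ sv]] := IH _ a z ltM aM zM za naz; exists v.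
exists m0 => // y z yM zM _ _ yz; apply: contraNT compl => nyz.
by apply/exists_inP; exists y => //; apply/exists_inP; exists z; rewrite // eq_sym yz.
Qed.

Lemma simplicial_exists I : I != set0 -> exists2 v, v \in I & simplicial I v.
Proof.
case/set0Pn=> u uI.
have [/exists_inP[a aI /exists_inP[z zI /andP[za naz]]]|compl] := boolP
    [exists a in I, [exists z in I, (z != a) && ~~ e a z]].
  by have [v [vI _ _ sv]] := simplicial_away aI zI za naz; exists v.
exists u => // y z yI zI _ _ yz; apply: contraNT compl => nyz.
by apply/exists_inP; exists y => //; apply/exists_inP; exists z; rewrite // eq_sym yz.
Qed.

Definition maximal_clique I (D : {set N}) : Prop :=
  [/\ D \subset I, D != set0, {in D &, forall y z, y != z -> e y z}
    & forall j, j \in I -> j \notin D -> exists2 z, z \in D & ~~ e j z].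

(** Maximal cliques avoiding a simplicial [v] stay maximal without [v]. A neighbour of [v] in the
    inductive [T] lies in every maximal clique through [v]; if there is none, [v] joins [T]. *)
Lemma chordal_strongly_perfect I : exists T,
  [/\ T \subset I, {in T &, forall y z, ~~ e y z}
    & forall D, maximal_clique I D -> D :&: T != set0].
Proof.
have [n] := ubnP #|I|; elim: n I => // n IH I leI.
have [->|I0] := eqVneq I set0.
  exists set0; split=> // [y z|D []]; first by rewrite inE.
  by rewrite subset0 => ->.
have [v vI sv] := simplicial_exists I0.
have [|T [TI sT hitT]] := IH (I :\ v).
  by move: leI; rewrite (cardsD1 v) vI.
have hit D : maximal_clique I D -> v \notin D -> D :&: T != set0.
  case=> DI D0 cD maxD vD; apply: hitT; split=> //; first by rewrite subsetD1 DI.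
  by move=> j /setD1P[_]; apply: maxD.
have TI' : T \subset I by apply: subset_trans TI (subsetDl _ _).
have [/exists_inP[t tT vt]|none] := boolP [exists t in T, e v t].
  exists T; split=> // D mD; have [vD|] := boolP (v \in D); last exact: hit.
  have [DI _ cD maxD] := mD.
  apply/set0Pn; exists t; rewrite inE tT andbT; apply: contraT => tD.
  have [z zD ntz] := maxD t (subsetP TI' t tT) tD.
  case/negP: ntz; have [->|zv] := eqVneq z v; first by rewrite e_sym.
  apply: sv => //; [exact: (subsetP TI')|exact: (subsetP DI)| |].
    by apply: cD; rewrite // eq_sym.
  by apply: contraNneq tD => ->.
have {}none t : t \in T -> ~~ e v t.
  by move=> tT; apply: contraNN none => vt; apply/exists_inP; exists t.
exists (v |: T); split.
- by rewrite subUset sub1set vI.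
- move=> y z /setU1P[->|yT] /setU1P[->|zT]; rewrite ?e_irr ?none //.
    by rewrite e_sym none.
  exact: sT.
move=> D mD; have [vD|vD] := boolP (v \in D).
  by apply/set0Pn; exists v; rewrite !inE vD eqxx.
have /set0Pn[z /setIP[zD zT]] := hit D mD vD.
by apply/set0Pn; exists z; rewrite !inE zD zT orbT.
Qed.

End Chordal.

(** * Transversals of clean sets *)

Lemma maximal_stable_subset (N : finType) (e : rel N) (U : {set N}) :
    symmetric e -> irreflexive e ->
  exists T : {set N}, [/\ T \subset U, stable e T &
    forall v, v \in U -> v \in T \/ exists2 z, z \in T & e v z].
Proof.
move=> e_sym e_irr.
have [|T /maxsetP[/andP[TU sT] maxT] _] :=
    @maxset_exists _ (fun T : {set N} => (T \subset U) && stable e T) set0.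
  by rewrite sub0set; apply/stableP => i j; rewrite inE.
exists T; split=> // v vU.
have [/exists_inP[z zT vz]|none] := boolP [exists z in T, e v z].
  by right; exists z.
left; rewrite -(maxT (v |: T)) ?setU11 ?subsetUr // subUset sub1set vU TU /=.
apply: stable_setU1 => // s sT'; rewrite e_sym; apply: contraNN none => vs.
by apply/exists_inP; exists s.
Qed.

(** Trades components for transitivity of adjacency off [A]; for co-unipolar graphs this is applied
    to the complement. *)
Lemma unipolar_cluster (N : finType) (e : rel N) : unipolar e ->
  exists A : {set N}, complete_on e A /\
    forall a b c, a \notin A -> b \notin A -> c \notin A ->
      e a b -> e b c -> a != c -> e a c.
Proof.
case=> A [cA comp]; exists A; split=> // a b c aA bA cA' ab bc ac.
have aC : a \in ~: A by rewrite inE.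
have step x y : x \notin A -> y \notin A -> e x y -> connect (induced e (~: A)) x y.
  by move=> xA yA xy; apply: connect1; rewrite /induced /= !inE xA yA.
have /complete_onP := comp a aC; apply=> //; rewrite inE ?aC ?connect0 //.
by rewrite inE cA' /=; apply: connect_trans (step _ _ aA bA ab) (step _ _ bA cA' bc).
Qed.

Lemma clique_of_set (N : finType) (e : rel N) (U : {set N}) :
    U != set0 -> {in U &, forall y z, y != z -> e y z} ->
  exists C : clique e, val C = U.
Proof.
move=> U0 /complete_onP cU.
have kU : clique_pred e U by rewrite /clique_pred U0.
by exists (Sub U kU).
Qed.

Section Classes.
Variables (R : realType) (N : finType) (e : rel N).
Variable mu : {ffun clique e -> R}.
Hypothesis e_sym : symmetric e.
Hypothesis e_irr : irreflexive e.
Implicit Types (C D : clique e) (I S T U : {set N}).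

Lemma co_chordal_hittable I : co_chordal e -> clean mu I -> hittable mu I.
Proof.
move=> chor cI; have [->|I0] := eqVneq I set0.
  exists set0; split=> //; first by apply/stableP => i j; rewrite inE.
have cs : symmetric (compl_graph e).
  by move=> a b; rewrite /compl_graph /= eq_sym e_sym.
have ci : irreflexive (compl_graph e).
  by move=> a; rewrite /compl_graph /= eqxx.
have [v vI sv] := simplicial_exists cs ci chor I0.
exists [set y in I | ~~ e v y]; split.
- by apply/subsetP => y; rewrite inE => /andP[].
- apply/stableP => y z; rewrite !inE => /andP[yI vy] /andP[zI vz].
  have [->|yz] := eqVneq y z; first by rewrite e_irr.
  have [<-//|yv] := eqVneq v y; have [<-|zv] := eqVneq v z; first by rewrite e_sym.
  by have /andP[] : compl_graph e y z by apply: sv; rewrite // /compl_graph /= ?yv ?zv.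
move=> C muC CI; have [vC|vC] := boolP (v \in val C).
  by apply/clique_meetsP; exists v; rewrite // inE vI e_irr.
have [z [zC zI vz]] := cI C v muC CI vI vC.
by apply/clique_meetsP; exists z; rewrite // inE zI.
Qed.

Lemma chordal_hittable I : chordal e -> clean mu I -> hittable mu I.
Proof.
move=> chor cI; have [T [TI sT hit]] := chordal_strongly_perfect e_sym e_irr chor I.
exists T; split=> //; first exact/stableP.
move=> C muC CI; have : (val C :&: I) :&: T != set0.
  apply: hit; split=> //; first exact: subsetIr.
    by move=> y z /setIP[yC _] /setIP[zC _]; exact: (cliqueE yC zC).
  move=> j jI; rewrite inE jI andbT => jC.
  have [z [zC zI nz]] := cI C j muC CI jI jC.
  by exists z; rewrite // inE zC.
by case/set0Pn=> z /setIP[/setIP[zC _] zT]; apply/clique_meetsP; exists z.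
Qed.

Section Tight.
Variable x : N -> R.
Hypothesis x_ge0 : forall i, 0 <= x i.
Hypothesis load_le1 : forall C, load x C <= 1.
Hypothesis support_tight : forall C, 0 < mu C -> load x C = 1.

Lemma set_load_le1 U : {in U &, forall y z, y != z -> e y z} ->
  \sum_(i in U) x i <= 1.
Proof.
have [->|U0] := eqVneq U set0; first by rewrite big_set0.
by move=> /(clique_of_set U0)[C <-]; apply: load_le1.
Qed.

Definition support := [set i | 0 < x i].

Lemma support_load C : load x C = \sum_(i in val C :&: support) x i.
Proof.
rewrite /load big_mkcond [RHS]big_mkcond; apply: eq_bigr => i _.
rewrite !inE; case: (i \in val C) => //=; case: ltP => // xi.
by apply/le_anti; rewrite xi x_ge0.
Qed.

Lemma support_meets C : 0 < mu C -> meets C support.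
Proof.
move=> /support_tight; rewrite support_load /meets; apply: contra_eqN => /eqP->.
by rewrite big_set0 eq_sym oner_eq0.
Qed.

(** The trace of a positive clique carries load 1, so a vertex of the support adjacent to all of it
    would give a clique of load above 1. Thus the state after Phase I is clean without pruning. *)
Lemma support_clean : clean mu support.
Proof.
move=> C j muC _ jI jC.
have [/exists_inP[z /setIP[zC zI] nz]|none] :=
  boolP [exists z in val C :&: support, ~~ e j z]; first by exists z.
have {}none z : z \in val C :&: support -> e j z.
  move=> zC; apply: contraNT none => nz; apply/exists_inP; exists z => //.
have : \sum_(i in j |: (val C :&: support)) x i <= 1.
  apply: set_load_le1 => y z /setU1P[->|yC] /setU1P[->|zC].
  - by rewrite eqxx.
  - by rewrite none.
  - by rewrite e_sym none.
  by case/setIP: yC => yC _; case/setIP: zC => zC _; exact: (cliqueE yC zC).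
rewrite big_setU1 ?inE ?(negPf jC) //= -support_load support_tight //.
by rewrite gerDr leNgt; move: jI; rewrite inE => ->.
Qed.

(** * Unipolar graphs: uncrossing tight cliques *)

Section Unipolar.
Hypothesis tight_support : forall C, load x C = 1 -> 0 < mu C.
Variable A : {set N}.
Hypothesis A_complete : complete_on e A.
Hypothesis cluster : forall a b c, a \notin A -> b \notin A -> c \notin A ->
  e a b -> e b c -> a != c -> e a c.

Let same a b := (a == b) || e a b.

Let same_sym a b : same a b = same b a.
Proof. by rewrite /same eq_sym e_sym. Qed.

Let same_trans a b c : a \notin A -> b \notin A -> c \notin A ->
  same a b -> same b c -> same a c.
Proof.
rewrite /same => aA bA cA /predU1P[->//|ab] /predU1P[<-|bc].
  by rewrite ab orbT.
by case: eqVneq => //= ac; apply: (@cluster a b c).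
Qed.

Let same_clique C a b : a \in val C -> b \in val C -> same a b.
Proof.
by move=> aC bC; rewrite /same; case: eqVneq => //= ab; apply: cliqueE aC bC ab.
Qed.

(* For [C1] = (X1, Y1) and [C2] = (X2, Y2), split along the component of [v] and
   [A], the sets (X1 :|: X2, Y1 :&: Y2) and (X1 :&: X2, Y1 :|: Y2) are again
   complete and have the same total load, hence are both tight. *)
Lemma uncross C1 C2 v : 0 < mu C1 -> 0 < mu C2 -> v \in val C1 -> v \notin A ->
    (exists y, [/\ y \in val C2, y \notin A & same v y]) ->
  exists C, 0 < mu C /\
    val C = ((val C1 :|: val C2) :&: A) :|: ((val C1 :&: val C2) :\: A).
Proof.
move=> mu1 mu2 vC1 vA [y [yC2 yA vy]].
set U := _ :|: _.
pose W := ((val C1 :|: val C2) :\: A) :|: ((val C1 :&: val C2) :&: A).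
have near z : z \in val C1 :|: val C2 -> z \notin A -> same v z.
  case/setUP=> [zC1|zC2] zA; first exact: same_clique vC1 zC1.
  by apply: (@same_trans v y z) => //; apply: same_clique yC2 zC2.
have sameE a b : same a b -> a != b -> e a b by case/predU1P=> [->|//]; rewrite eqxx.
have complete_A a b : a \in A -> b \in A -> a != b -> e a b by apply/complete_onP.
have mixed a b : a \in val C1 :|: val C2 -> b \in val C1 :&: val C2 -> a != b -> e a b.
  by case/setUP=> aC /setIP[b1 b2]; apply: cliqueE aC _.
have loadW : \sum_(i in W) x i <= 1.
  apply: set_load_le1 => a b.
  case/setUP=> [/setDP[aC aA]|/setIP[aC aA]] /setUP[/setDP[bC bA]|/setIP[bC bA]].
  - by apply: sameE; apply: (@same_trans a v b); rewrite ?near // same_sym near.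
  - exact: mixed.
  - by rewrite eq_sym e_sym; apply: mixed.
  - exact: complete_A.
have cU : {in U &, forall a b, a != b -> e a b}.
  move=> a b.
  case/setUP=> [/setIP[aC aA]|/setDP[aC aA]] /setUP[/setIP[bC bA]|/setDP[bC bA]].
  - exact: complete_A.
  - exact: mixed.
  - by rewrite eq_sym e_sym; apply: mixed.
  - by case/setIP: aC => aC _; case/setIP: bC => bC _; exact: (cliqueE aC bC).
(* [U] and [W] count every vertex as often as [C1] and [C2] do, so both loads, being at most 1,
   equal 1; strict complementarity then makes the clique on [U] positive. *)
have sumUW : \sum_(i in U) x i + \sum_(i in W) x i = 2.
  rewrite (_ : 2 = load x C1 + load x C2); last by rewrite !support_tight.
  rewrite /load big_mkcond [X in _ + X]big_mkcond -big_split /=.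
  rewrite [X in _ = X + _]big_mkcond [X in _ = _ + X]big_mkcond -big_split /=.
  apply: eq_bigr => i _; rewrite !inE.
  by case: (i \in val C1); case: (i \in val C2); case: (i \in A);
    rewrite /= ?addr0 ?add0r.
have geU : 1 <= \sum_(i in U) x i by lra.
have U0 : U != set0.
  by apply: contraTneq geU => ->; rewrite big_set0 ler10.
have [C CU] := clique_of_set U0 cU.
exists C; split=> //; apply: tight_support; apply/le_anti; rewrite load_le1 /load.
by rewrite CU.
Qed.

Lemma unipolar_hittable I : clean mu I -> hittable mu I.
Proof.
move=> cI; have complete_A := complete_onP _ _ A_complete.
have [AI0|[b /setIP[bA bI]]] := set_0Vmem (A :&: I).
  have nA z : z \in I -> z \notin A.
    by move=> zI; apply/negP => zA; move/setP/(_ z): AI0; rewrite !inE zA zI.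
  (* Here [I] is a disjoint union of cliques and, by cleanness, each nonempty trace of a positive
     clique is a whole one of them. *)
  have [T [TI sT maxT]] := maximal_stable_subset I e_sym e_irr.
  exists T; split=> // C muC CI; have /clique_meetsP[v vC vI] := CI.
  have [vT|[z zT vz]] := maxT v vI; apply/clique_meetsP; first by exists v.
  have zI := subsetP TI z zT; exists z => //; apply: contraT => zC.
  have [y [yC yI /negP[]]] := cI C z muC CI zI zC.
  have : same z y.
    apply: (@same_trans z v y); rewrite ?nA //; last exact: same_clique vC yC.
    by rewrite /same e_sym vz orbT.
  by case/predU1P=> // zy; rewrite zy yC in zC.
pose near v D := [exists y in val D, (y \notin A) && same v y].
(* Possible representatives of components off [A]: each lies in all positive cliques that avoid [b],
   meet [I] and reach its component. [T] takes one per component. *)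
pose V := [set v in I | [&& v \notin A, ~~ e b v & [forall D : clique e,
  [&& 0 < mu D, b \notin val D, meets D I & near v D] ==> (v \in val D)]]].
have [T [TV sT maxT]] := maximal_stable_subset V e_sym e_irr.
have VI v : v \in V -> v \in I by rewrite inE => /andP[].
have nA D z : b \notin val D -> z \in val D -> ~~ e b z -> z \notin A.
  move=> bD zD; apply: contraNN => zA; apply: complete_A => //.
  by apply: contraNneq bD => ->.
exists (b |: T); split.
- rewrite subUset sub1set bI; apply/subsetP => v /(subsetP TV); apply: VI.
- apply: stable_setU1 => // v /(subsetP TV); rewrite inE e_sym.
  by case/and4P.
move=> D muD DI; apply/clique_meetsP.
have [bD|bD] := boolP (b \in val D); first by exists b; rewrite // setU11.
(* One vertex of [V] in [D] is enough: the representative of its component chosen in [T] lies in [D]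
   too, by the definition of [V]. *)
suff [v vV vD] : exists2 v, v \in V & v \in val D.
  have [vT|[z zT vz]] := maxT v vV; first by exists v; rewrite // setU1r.
  exists z; last by rewrite setU1r.
  have := subsetP TV z zT; rewrite inE => /and4P[_ zA _ /forallP/(_ D)/implyP].
  apply; rewrite muD bD DI; apply/exists_inP; exists v => //.
  by move: vV; rewrite inE => /and4P[_ -> _ _]; rewrite /same e_sym vz orbT.
have [v0 [v0D v0I nbv0]] := cI D b muD DI bI bD.
have v0A := nA D v0 bD v0D nbv0.
pose cand D' := [&& 0 < mu D', b \notin val D', meets D' I & near v0 D'].
have candD : cand D.
  rewrite /cand muD bD DI; apply/exists_inP; exists v0 => //.
  by rewrite v0A /same eqxx.
(* Among the cliques competing for the component of [v0], [D1] has the smallest trace off [A]; its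
   vertices in [I] not adjacent to [b] will belong to [V]. *)
have [D1 /and4P[mu1 bD1 D1I /exists_inP[y1 y1D1 /andP[y1A v0y1]]] minD1] :=
  @arg_minnP _ D cand (fun D' => #|(val D' :&: I) :\: A|) candD.
have [v [vD1 vI nbv]] := cI D1 b mu1 D1I bI bD1.
have vA := nA D1 v bD1 vD1 nbv.
have v0v : same v0 v.
  by apply: (@same_trans v0 y1 v) => //; apply: same_clique y1D1 vD1.
suff vV : v \in V.
  exists v => //; move: vV; rewrite inE => /and4P[_ _ _ /forallP/(_ D)/implyP].
  apply; rewrite muD bD DI; apply/exists_inP; exists v0 => //.
  by rewrite v0A same_sym.
rewrite inE vI vA nbv; apply/forallP => D'; apply/implyP.
case/and4P=> mu' bD' D'I /exists_inP[y' y'D' /andP[y'A vy']].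
apply: contraT => vD'.
have [|C [muC CE]] := uncross mu1 mu' vD1 vA; first by exists y'.
have bC : b \notin val C by rewrite CE !inE bA (negPf bD1) (negPf bD').
(* If the uncrossed clique [C] meets [I], it competes as well, and its trace off [A] is contained in
   that of [D1] and lacks [v]. *)
have [CI|nCI] := boolP (meets C I).
  have [z [zC zI nbz]] := cI C b muC CI bI bC.
  have zA := nA C z bC zC nbz.
  have zD1 : z \in val D1.
    by move: zC; rewrite CE !inE (negPf zA) !andbF /= => /andP[].
  have : cand C.
    rewrite /cand muC bC CI; apply/exists_inP; exists z => //; rewrite zA /=.
    by apply: (@same_trans v0 v z) => //; apply: same_clique vD1 zD1.
  move=> /minD1; rewrite leqNgt => /negP[]; apply: proper_card.
  apply/properP; split.
    apply/subsetP => a; rewrite CE !inE; case: (a \in A) => //=.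
    by rewrite andbF /= => /andP[/andP[-> _] ->].
  by exists v; rewrite ?CE !inE (negPf vA) ?vI ?vD1 //= (negPf vD') ?andbF.
(* Otherwise [D'] has no vertex in [A :&: I], as [C] contains [D'] within [A]; its trace then lies
   in the component of [v] and is adjacent to [v], against cleanness. *)
have [z [zD' zI nvz]] := cI D' v mu' D'I vI vD'.
have zA : z \notin A.
  apply: contraNN nCI => zA; apply/clique_meetsP; exists z => //.
  by rewrite CE !inE zD' zA orbT.
have : same v z.
  by apply: (@same_trans v y' z) => //; apply: same_clique y'D' zD'.
by case/predU1P=> [vz|]; [rewrite -vz (negPf vD') in zD' | rewrite (negPf nvz)].
Qed.

End Unipolar.

(** * Co-unipolar graphs: thresholding and bipartite remainders *)

Section CoUnipolar.
Variable A : {set N}.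
Hypothesis A_stable : stable e A.
Hypothesis multipartite : forall a b c, a \notin A -> b \notin A -> c \notin A ->
  ~~ e a b -> ~~ e b c -> ~~ e a c.
Variable i : N.
Hypothesis iA : i \notin A.

(** The class of [i] in the complete multipartite graph induced off [A]. *)
Definition part := [set y | (y \notin A) && ~~ e i y].

Lemma part_stable : {in part &, forall y z, ~~ e y z}.
Proof.
move=> y z; rewrite !inE => /andP[yA iy] /andP[zA iz].
by apply: (@multipartite y i z); rewrite // e_sym.
Qed.

Lemma part_complete b z : b \in part -> z \notin A -> z \notin part -> e b z.
Proof.
rewrite !inE => /andP[bA ib] zA; rewrite zA /= negbK; apply: contraTT => bz.
exact: (@multipartite i b z).
Qed.

(** Take [A :&: I] and the vertices of the part without neighbours in it. A positive clique missing
    [A :&: I] has a single vertex as trace, and cleanness forbids that vertex a neighbour in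
    [A :&: I]. *)
Lemma bipartite_hittable I : I \subset A :|: part -> clean mu I -> hittable mu I.
Proof.
move=> IAB cI; pose AI := A :&: I.
pose B := [set b in I :&: part | [forall a in AI, ~~ e a b]].
have BP b : b \in B -> [/\ b \in I, b \in part & forall a, a \in AI -> ~~ e a b].
  by rewrite 2!inE => /andP[/andP[bI bp] /forall_inP h].
exists (AI :|: B); split.
- by rewrite subUset subsetIr; apply/subsetP => b /BP[].
- apply/stableP => y z /setUP[yA|/BP[_ yp yB]] /setUP[zA|/BP[_ zp zB]].
  + by have /stableP := A_stable; apply; [case/setIP: yA | case/setIP: zA].
  + exact: zB.
  + by rewrite e_sym; apply: yB.
  + exact: part_stable.
move=> C muC CI; apply/clique_meetsP.
have [/exists_inP[a aA aC]|none] := boolP [exists a in AI, a \in val C].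
  by exists a; rewrite // inE aA.
have CA z : z \in val C -> z \in I -> z \in part.
  move=> zC zI; have /setUP[zA|//] := subsetP IAB z zI.
  by case/negP: none; apply/exists_inP; exists z; rewrite // inE zA.
have /clique_meetsP[v vC vI] := CI; exists v => //; apply/setUP; right.
rewrite 2!inE vI CA //=; apply/forall_inP => a aAI; apply/negP => av.
have aI : a \in I by case/setIP: aAI.
have aC : a \notin val C.
  by apply: contraNN none => aC; apply/exists_inP; exists a.
have [z [zC zI naz]] := cI C a muC CI aI aC.
have vz : v != z by apply: contraTneq av => ->.
by have := part_stable (CA v vC vI) (CA z zC zI); rewrite (cliqueE vC zC).
Qed.

Hypothesis xi : 0 < x i.

(* The vertices of the part of [i] whose value is at least [x i], together with
   all vertices of [A] that have no neighbour among them: for a tight clique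
   containing the neighbour [a] of some such [b], replacing its vertex in the
   part of [i] by [b] shows that this vertex has value at least [x b]. *)
Lemma co_unipolar_good : exists T,
  [/\ T \subset support, stable e T, transversal mu support T & i \in T].
Proof.
pose B := [set b in part | x i <= x b].
have BP b : b \in B -> b \in part /\ x i <= x b by rewrite 2!inE => /andP[].
have BS b : b \in B -> b \in support by move=> /BP[_]; rewrite inE; apply: lt_le_trans.
pose A' := [set a in A :&: support | [forall b in B, ~~ e a b]].
have A'P a : a \in A' -> [/\ a \in A, a \in support & forall b, b \in B -> ~~ e a b].
  by rewrite 2!inE => /andP[/andP[aA aS] /forall_inP h].
have ip : i \in part by rewrite inE iA e_irr.
have iB : i \in B by rewrite inE ip /=.
exists (A' :|: B); split; last by rewrite inE iB orbT.
- by rewrite subUset; apply/andP; split; apply/subsetP => z; [case/A'P | exact: BS].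
- apply/stableP => y z /setUP[/A'P[yA _ yB]|yB] /setUP[/A'P[zA _ zB]|zB].
  + by have /stableP := A_stable; apply.
  + exact: yB.
  + by rewrite e_sym; apply: zB.
  + by apply: part_stable; [case: (BP y yB) | case: (BP z zB)].
move=> C muC _.
have exchange b : b \in B ->
    (forall a, a \in val C -> a \in A -> a \in support -> e b a) -> meets C B.
  move=> bB ba; have [bp xib] := BP b bB.
  have le : \sum_(z in b |: ((val C :&: support) :\: part)) x z <= 1.
    have bz z : z \in (val C :&: support) :\: part -> e b z.
      case/setDP=> /setIP[zC zS] zp; have [zA|zA] := boolP (z \in A); first exact: ba.
      exact: part_complete.
    apply: set_load_le1 => y z /setU1P[->|yC] /setU1P[->|zC]; rewrite ?eqxx //.
    + by move=> _; apply: bz.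
    + by move=> _; rewrite e_sym; apply: bz.
    case/setDP: yC => /setIP[yC _] _; case/setDP: zC => /setIP[zC _] _.
    exact: (cliqueE yC zC).
  apply: contraT => nCB; have small y : y \in val C -> y \in part -> x y < x i.
    move=> yC yp; rewrite ltNge; apply: contraNN nCB => xy.
    by apply/clique_meetsP; exists y; rewrite // inE yp.
  (* [C] has at most one support vertex in the part, of value below [x i <= x b]; exchanging it for
     [b] would push the load above 1. *)
  move: le; rewrite big_setU1 ?in_setD ?bp //= leNgt => /negP[].
  rewrite -(support_tight muC) support_load (big_setID part) /= ltrD2r.
  apply: lt_le_trans xib.
  have [->|[y /setIP[/setIP[yC yS] yp]]] := set_0Vmem (val C :&: support :&: part).
    by rewrite big_set0.
  rewrite (_ : _ :&: part = [set y]) ?big_set1; first exact: small.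
  apply/setP => z; rewrite !inE; apply/idP/eqP => [/andP[/andP[zC _] zp]|->].
    have zp' : z \in part by rewrite inE.
    by apply: contraNeq (part_stable yp zp') => zy; rewrite (cliqueE yC zC) // eq_sym.
  by move: yS yp; rewrite yC !inE => -> ->.
suff : meets C A' \/ meets C B by case; apply: meetsS; rewrite ?subsetUl ?subsetUr.
(* [C] has at most one vertex [a] in [A]. If [a] is excluded from [A'], a neighbour of it in [B] can
   be exchanged in; if the support contains no such [a], [i] itself can. *)
have [/exists_inP[a /setIP[aA aS] aC]|none] :=
  boolP [exists a in A :&: support, a \in val C].
  have [aA'|] := boolP (a \in A'); first by left; apply/clique_meetsP; exists a.
  rewrite 2!inE aA aS /= => /forall_inPn[b bB]; rewrite negbK => ab.
  right; apply: (exchange b bB) => a' a'C a'A _.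
  suff -> : a' = a by rewrite e_sym.
  have /stableP/(_ a' a a'A aA) := A_stable.
  by have [->//|ne] := eqVneq a' a; rewrite (cliqueE a'C aC ne).
right; apply: (exchange i iB) => a aC aA aS.
by case/negP: none; apply/exists_inP; exists a; rewrite // inE aA.
Qed.

End CoUnipolar.
End Tight.
End Classes.

(** The look-ahead accepts [i], which lies in a transversal. Afterwards no neighbour of [i] remains,
    so the state is contained in the union of two stable sets, [A] and the part of [i]. *)
Lemma co_unipolar_rounding_from (R : realType) (N : finType) (e : rel N) (w : N -> R)
    (x : {ffun N -> R}) (mu : {ffun clique e -> R}) (A : {set N}) i :
    symmetric e -> irreflexive e ->
    primal_optimal e w x -> dual_optimal w mu -> stable e A ->
    (forall a b c, a \notin A -> b \notin A -> c \notin A ->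
       ~~ e a b -> ~~ e b c -> ~~ e a c) ->
    i \notin A -> i \in phase1 x ->
  forall T, rounding_from e w (VLP mu) i x T -> mwss e w T.
Proof.
move=> e_sym e_irr x_opt mu_opt sA multi iA ix T.
have [[x0 x1] _] := x_opt; have muf := mu_opt.1.
have tight := dual_support_tight x_opt mu_opt.
have I0_tight : {in phase1 x, forall j, cover mu j = w j}.
  by move=> j; rewrite inE; apply: primal_support_tight.
have xi : 0 < x i by move: ix; rewrite inE.
have [U [US sU trU iU]] := co_unipolar_good e_sym e_irr x0 x1 tight sA multi iA xi.
have leV : \sum_C mu C <= VLP mu (phase1 x).
  rewrite VLPE; apply: ler_sum => C _.
  have := muf.1 C; rewrite le_eqVlt => /predU1P[<-|muC]; first by rewrite mul0r.
  by rewrite (support_meets x0 tight muC) mulr1.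
case=> st [/= _ [I' pI' ->]].
have good := good_choice muf I0_tight (subxx _) US sU trU iU pI'.
rewrite ltNge good /= => ph.
have I'sub := prune_sub pI'.
have I'I0 : I' \subset phase1 x by apply: subset_trans I'sub (subsetDl _ _).
have hit (I : {set N}) : I \subset I' -> clean mu I -> hittable mu I.
  move=> II'; apply: (bipartite_hittable e_sym sA multi (i := i)) => //.
  apply/subsetP => z /(subsetP II')/(subsetP I'sub)/setDP[_].
  by rewrite !inE negb_or => /andP[_ ->]; rewrite andbT orbN.
apply: (phase2_mwss e_sym e_irr muf I0_tight I'I0 hit ph) => //=.
- by apply: hit => //; apply: prune_clean pI' (subsetDl _ _).
- by apply: stable_setU1 => // [|s]; [apply/stableP => a b|]; rewrite inE.
- move=> s v; rewrite setU0 inE => /eqP-> /(subsetP I'sub)/setDP[_].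
  by rewrite !inE negb_or eq_sym.
by rewrite setU0 big_set1 addrC; apply: le_trans leV _.
Qed.

Theorem theorem2p10 (R : realType) (N : finType) (e : rel N) (w : N -> R)
    (x : {ffun N -> R}) (mu : {ffun clique e -> R})
    (e_sym : symmetric e) (e_irr : irreflexive e)
    (w_gt0 : forall i, 0 < w i)
    (x_opt : relint (primal_optimal e w) x)
    (mu_opt : relint (dual_optimal w) mu) :
  (unipolar e \/ chordal e \/ co_chordal e ->
     forall T, rounding e w (VLP mu) x T -> mwss e w T)
  /\
  (co_unipolar e ->
     forall i j, i \in phase1 x -> j \in phase1 x -> e i j ->
       (forall T, rounding_from e w (VLP mu) i x T -> mwss e w T) \/
       (forall T, rounding_from e w (VLP mu) j x T -> mwss e w T)).
Proof.
have [xo muo] := (x_opt.1, mu_opt.1); have [[x0 x1] _] := xo; have muf := muo.1.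
have tight := dual_support_tight xo muo.
split=> [class T rT|cu i j ix jx ij].
  have I0_tight : {in phase1 x, forall j, cover mu j = w j}.
    by move=> j; rewrite inE; apply: primal_support_tight.
  have hit (I : {set N}) : I \subset phase1 x -> clean mu I -> hittable mu I.
    move=> _; case: class => [/unipolar_cluster[A [cA clu]]|[ch|cch]].
    - apply: (unipolar_hittable e_sym e_irr x1 tight _ cA clu) => C.
      exact: (strictly_complementary x_opt mu_opt).
    - exact: chordal_hittable.
    - exact: co_chordal_hittable.
  apply: (phase2_mwss e_sym e_irr muf I0_tight (subxx _) hit rT) => //=.
  - by apply: hit => //; apply: support_clean.
  - by apply/stableP => a b; rewrite inE.
  - by move=> s v; rewrite inE.
  rewrite big_set0 add0r VLPE; apply: ler_sum => C _.
  have := muf.1 C; rewrite le_eqVlt => /predU1P[<-|muC]; first by rewrite mul0r.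
  by rewrite (support_meets x0 tight muC) mulr1.
have [A [cA clu]] := unipolar_cluster cu.
have sA : stable e A.
  apply/stableP => a b aA bA; have [->|ab] := eqVneq a b; first by rewrite e_irr.
  by have /complete_onP/(_ a b aA bA ab)/andP[] := cA.
have multi a b c : a \notin A -> b \notin A -> c \notin A ->
    ~~ e a b -> ~~ e b c -> ~~ e a c.
  move=> aA bA cA' ab bc.
  have [->|ac] := eqVneq a c; first by rewrite e_irr.
  have [abE|ab'] := eqVneq a b; first by rewrite abE.
  have [bcE|bc'] := eqVneq b c; first by rewrite -bcE.
  by have /andP[] := clu a b c aA bA cA'
    (introT andP (conj ab' ab)) (introT andP (conj bc' bc)) ac.
have [iA|iA] := boolP (i \in A); last first.
  by left; apply: co_unipolar_rounding_from multi iA ix.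
right; apply: co_unipolar_rounding_from multi _ jx => //.
apply/negP => jA; have /stableP/(_ i j iA jA) := sA.
by rewrite ij.
Qed.
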